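(* Let $\mathbf a,\mathbf b,\mathbf c$ be compositions of the same integer $n\ge 1$, and let $p,q,r$ denote their respective numbers of non-zero parts. Assume (without loss of generality) that $p\le q\le r$. Then the triple $(\mathbf a,\mathbf b,\mathbf c)$ is of finite type if and only if it belongs to at least one of the following classes: - ($A_{q,r}$) $(p,q,r)=(1,q,r)$, $1\le q\le r$; - ($D_{r+2}$) $(p,q,r)=(2,2,r)$, $2\le r$; - ($E_6$) $(p,q,r)=(2,3,3)$; - ($E_7$) $(p,q,r)=(2,3,4)$; - ($E_8$) $(p,q,r)=(2,3,5)$; - ($E^{(a)}_{r+3}$) $(p,q,r)=(2,3,r)$, $3\le r$, $\min(\mathbf a)=2$; - ($E^{(b)}_{r+3}$) $(p,q,r)=(2,3,r)$, $3\le r$, $\min(\mathbf b)=1$; - ($S_{q,r}$) $(p,q,r)=(2,q,r)$, $2\le q\le r$, $\min(\mathbf a)=1$.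
   Context: All vector spaces are over a fixed algebraically closed field. A composition of $n$ is a list $\mathbf a=(a_1,\ldots,a_s)$ of nonnegative integers (the parts; zero parts are allowed) with sum $n$. $\min(\mathbf a)$ denotes the minimum of the non-zero parts of $\mathbf a$. For a vector space $V$ of dimension $n$, $\mathrm{Fl}_{\mathbf a}(V)$ is the variety of flags $A=(0=A_0\subset A_1\subset\cdots\subset A_s=V)$ of subspaces of $V$ with $\dim(A_i/A_{i-1})=a_i$ for $i=1,\ldots,s$. A triple $(\mathbf a,\mathbf b,\mathbf c)$ of compositions of the same number $n$ is of finite type if $GL(V)$, acting diagonally, has finitely many orbits in $\mathrm{Fl}_{\mathbf a}(V)\times\mathrm{Fl}_{\mathbf b}(V)\times\mathrm{Fl}_{\mathbf c}(V)$, where $\dim V=n$. *)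

(* Defs.v *)
From HB Require Import structures.
From mathcomp Require Import all_boot all_order all_algebra.
From mathcomp Require Import classical_sets cardinality.

Set Implicit Arguments.
Unset Strict Implicit.
Unset Printing Implicit Defensive.

Local Open Scope classical_set_scope.

(* A composition of n is a list a : seq nat with sumn a = n; zero parts are
   allowed. *)
Definition nonzero_parts (a : seq nat) : seq nat := [seq x <- a | x != 0].

(* The head of the list only serves as a seed for the minimum; the value is 0
   when there is no non-zero part. *)
Definition min_part (a : seq nat) : nat :=
  \big[minn/head 0 (nonzero_parts a)]_(x <- nonzero_parts a) x.

Section Flags.
Variables (K : fieldType) (V : vectType K).

(* A flag (A_0, ..., A_s) is a list of length s + 1, where s = size a; the part
   written a_(i+1) in 1-based indexing is nth 0 a i. *)
Definition Fl (a : seq nat) : set (seq {vspace V}) :=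
  [set A | [/\ size A = (size a).+1,
               nth 0%VS A 0 = 0%VS,
               nth 0%VS A (size a) = fullv
             & forall i, i < size a ->
                 (nth 0 A i <= nth 0 A i.+1)%VS /\
                 (\dim (nth 0 A i.+1)%VS = \dim (nth 0 A i)%VS + nth 0 a i :> nat)]].

Definition GL : set 'End(V) := [set g | bijective g].

Definition flag_act (g : 'End(V)) (A : seq {vspace V}) : seq {vspace V} :=
  [seq (g @: U)%VS | U <- A].

Definition flag3_act (g : 'End(V))
    (X : seq {vspace V} * seq {vspace V} * seq {vspace V}) :=
  (flag_act g X.1.1, flag_act g X.1.2, flag_act g X.2).

Definition GL_orbit (X : seq {vspace V} * seq {vspace V} * seq {vspace V}) :=
  [set flag3_act g X | g in GL].

Definition finite_type (a b c : seq nat) : Prop :=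
  finite_set [set GL_orbit X | X in Fl a `*` Fl b `*` Fl c].

End Flags.

Arguments finite_type {K} V a b c.

(* Main.v *)
From HB Require Import structures.
Require Import Defs.
From mathcomp Require Import all_boot all_order all_algebra.
From mathcomp Require Import zify finmap.
From mathcomp Require Import boolp classical_sets cardinality.

(* A triple of flags is a vector space V with three filtrations; a subspace
   with its induced filtrations is a subobject whose jumps are bounded by those
   of V.  Write <X, Y> = dim Hom(X, Y) - dim Ext(X, Y) for the Euler form of
   filtered spaces; 2 <X, X> is the sum of the squares of all jumps minus
   (dim X)^2.

   Finiteness.  In each listed class <X, X> > 0 for every nonzero subobject, by
   Cauchy-Schwarz and the bounds on the jumps.  By Ringel's argument an
   indecomposable X is then a brick (End X = K): otherwise some indecomposable
   subobject is a brick with self-extensions, hence has Euler form <= 0.  A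
   brick with positive Euler form is rigid (Ext(X, X) = 0), and two rigid
   objects with the same jumps are isomorphic: both are isomorphic to the
   generic member of a line joining them.  So the orbit of a triple is
   determined by the multiset of jump vectors of its indecomposable summands.

   Infiniteness.  Outside the list the jumps dominate those of one of the
   critical types (111|111|111), (22|1111|1111), (33|222|111111).  Each of
   these carries a family M_x, x in K, with Hom(M_x, M_y) = 0 for x <> y;
   after adding a fixed complement, the members lying in one orbit give
   linearly independent vectors, hence finitely many of them. *)

Set Implicit Arguments.
Unset Strict Implicit.
Unset Printing Implicit Defensive.

Import GRing.Theory.
Local Open Scope ring_scope.

(** * Rigidity of matrix data *)

Section Observation.
Variables (I : finType) (m : nat) (S : pred (I * 'I_m * 'I_m)).

Section Ring.
Variables (R : comNzRingType) (G H : I -> 'M[R]_m).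

(** With [G k] a chart, [H k] the inverse of a chart and [S] the places forced to vanish, the kernel
    of [obs] is the space of filtered maps and its cokernel is Ext^1. *)
Definition obs (M : 'M[R]_m) : 'rV[R]_#|S| :=
  \row_y let x := enum_val y in (G x.1.1 *m M *m H x.1.1) x.1.2 x.2.

Lemma obsE M y : obs M 0 y = let x := enum_val y in
  (G x.1.1 *m M *m H x.1.1) x.1.2 x.2.
Proof. by rewrite mxE. Qed.

Lemma obs_is_linear : linear obs.
Proof.
move=> a M N; apply/rowP=> y; rewrite [RHS]mxE [in RHS]mxE !obsE /=.
by rewrite mulmxDr mulmxDl -scalemxAr -scalemxAl mxE [in LHS]mxE.
Qed.

HB.instance Definition _ :=
  GRing.isLinear.Build R 'M[R]_m 'rV[R]_#|S| _ obs obs_is_linear.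

Definition obs_mx : 'M[R]_(m * m, #|S|) := lin1_mx (obs \o vec_mx).

Lemma mxvec_obs M : mxvec M *m obs_mx = obs M.
Proof. by rewrite mul_rV_lin1 /= mxvecK. Qed.

Lemma obsP M : reflect (forall x, S x -> (G x.1.1 *m M *m H x.1.1) x.1.2 x.2 = 0)
                       (obs M == 0).
Proof.
apply: (iffP eqP) => [/rowP obs0 x Sx|obs0].
  by have := obs0 (enum_rank_in Sx x); rewrite obsE mxE enum_rankK_in.
apply/rowP=> y; rewrite obsE mxE; apply: obs0; apply: enum_valP.
Qed.

End Ring.

Lemma map_obs_mx (R R' : comNzRingType) (f : {rmorphism R -> R'})
    (G H : I -> 'M[R]_m) :
  map_mx f (obs_mx G H) = obs_mx (map_mx f \o G) (map_mx f \o H).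
Proof.
apply/matrixP=> i y; rewrite mxE 2![in LHS]mxE [RHS]mxE [in RHS]mxE /=.
rewrite -(map_delta_mx f) -map_vec_mx -!map_mxM.
by rewrite [RHS]mxE.
Qed.

(* If W is a left inverse of L(0), then det(W L) id - id L adj(W L) W is killed
   by L and specializes to the identity at 0. *)
Lemma row_full_deform (K : fieldType) (A B : I -> 'M[{poly K}]_m) :
  let at_ t := map_mx (horner_eval t) : 'M_m -> 'M_m in
  obs (at_ 0 \o A) (at_ 0 \o B) 1%:M = 0 ->
  row_full (obs_mx (at_ 0 \o A) (at_ 0 \o B)) ->
  exists2 d : {poly K}, d != 0 & forall t, d.[t] != 0 ->
    exists2 M, M \in unitmx & obs (at_ t \o A) (at_ t \o B) M = 0.
Proof.
move=> at_ obs1 /row_fullP[W WL1].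
pose L := obs_mx A B.
have Lat t : map_mx (horner_eval t) L = obs_mx (at_ t \o A) (at_ t \o B).
  exact: map_obs_mx.
pose W' := map_mx polyC W; pose E := W' *m L.
have Wat t : map_mx (horner_eval t) W' = W.
  by rewrite -map_mx_comp map_mx_id // => x /=; rewrite /horner_eval hornerC.
pose id_ := mxvec (1%:M : 'M[{poly K}]_m).
have idat t : map_mx (horner_eval t) id_ = mxvec 1%:M.
  by rewrite map_mxvec map_mx1.
pose f := \det E *: id_ - id_ *m L *m \adj E *m W'.
have fL : f *m L = 0.
  by rewrite mulmxBl -scalemxAl -!mulmxA mul_adj_mx -/E mul_mx_scalar -scalemxAr subrr.
have f0 : map_mx (horner_eval 0) (vec_mx f) = 1%:M.
  rewrite map_vec_mx map_mxB map_mxZ !map_mxM /= map_mx_adj Lat Wat idat.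
  rewrite mxvec_obs obs1 !mul0mx subr0.
  have -> : horner_eval 0 (\det E) = 1.
    by rewrite -det_map_mx map_mxM Lat Wat WL1 det1.
  by rewrite scale1r mxvecK.
(* This polynomial takes the value 1 at 0, so it is not zero; away from its roots the specialized
   lift is invertible. *)
exists (\det (vec_mx f)).
  apply/eqP=> d0; have : horner_eval 0 (\det (vec_mx f)) = 1.
    by rewrite -det_map_mx f0 det1.
  by rewrite d0 rmorph0 => /eqP; rewrite eq_sym oner_eq0.
move=> t dt; exists (map_mx (horner_eval t) (vec_mx f)).
  by rewrite unitmxE det_map_mx unitfE.
by rewrite -mxvec_obs -map_mxvec vec_mxK -Lat -map_mxM fL map_mx0.
Qed.

End Observation.

Section Rigid.
Variables (K : closedFieldType) (I : finType) (m : nat).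
Variable S : pred (I * 'I_m * 'I_m).
Implicit Types G : I -> 'M[K]_m.

(** Surjectivity of [obs], that is, vanishing of the cokernel Ext^1. *)
Definition rigid_mx G := row_full (obs_mx S G (invmx \o G)).

(** The kernel of [obs] lies on the line of scalar matrices, so the rank is at least m^2 - 1, and
    there are at most that many observed entries. *)
Lemma brick_rigid_mx G :
    (forall M, obs S G (invmx \o G) M = 0 -> exists c, M = c%:M) ->
  (#|S| < m * m)%N -> rigid_mx G.
Proof.
move=> brickG ltSm; set L := obs_mx S G (invmx \o G).
have sub_ker : (kermx L <= mxvec (1%:M : 'M[K]_m))%MS.
  apply/row_subP=> i; have: row i (kermx L) *m L = 0 by rewrite -row_mul mulmx_ker row0.
  rewrite -[row i _]vec_mxK mxvec_obs => /brickG[c ->].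
  by rewrite -(scalemx1 _ c) linearZ_LR scalemx_sub.
have := leq_trans (mxrankS sub_ker) (rank_leq_row _).
rewrite mxrank_ker /rigid_mx /row_full -/L => rk.
by rewrite eqn_leq rank_leq_col /=; lia.
Qed.

Lemma rigid_mx_solve G y : rigid_mx G -> exists M, obs S G (invmx \o G) M = y.
Proof.
move=> /row_fullP[W WL]; exists (vec_mx (y *m W)).
by rewrite -mxvec_obs vec_mxK -mulmxA WL mulmx1.
Qed.

Hypothesis S_irr : forall k i, ~~ S (k, i, i).
Hypothesis S_split : forall k i j l, S (k, i, j) -> S (k, i, l) || S (k, l, j).

(** By [S_irr] and [S_split], for each k the matrices vanishing on [S] contain 1 and are closed
    under product. Let Z_t = G + t (G' - G). Rigidity of each end deforms the identity into
    invertible maps Z_t -> G and G' -> Z_t for all but finitely many t; at a common good t they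
    compose to a map G' -> G. *)
Lemma rigid_mx_unique G G' :
    (forall k, G k \in unitmx) -> (forall k, G' k \in unitmx) ->
    rigid_mx G -> rigid_mx G' ->
  exists2 M, M \in unitmx & obs S G' (invmx \o G) M = 0.
Proof.
move=> uG uG' rG rG'.
pose C := map_mx polyC : 'M[K]_m -> 'M_m.
pose path_ X Y (k : I) : 'M[{poly K}]_m := C (X k) + 'X *: C (Y k - X k).
have CE t M : map_mx (horner_eval t) (C M) = M.
  by rewrite -map_mx_comp map_mx_id // => x /=; rewrite /horner_eval hornerC.
have pathE t X Y k : map_mx (horner_eval t) (path_ X Y k) = X k + t *: (Y k - X k).
  by rewrite map_mxD map_mxZ !CE /= /horner_eval hornerX.
have path0 X Y k : map_mx (horner_eval 0) (path_ X Y k) = X k.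
  by rewrite pathE scale0r addr0.
have obs1 X : (forall k, X k \in unitmx) -> obs S X (invmx \o X) 1%:M = 0.
  by move=> uX; apply/eqP/obsP=> -[[k i] j] Sx /=; rewrite mulmx1 mulmxV // mxE;
    case: eqP Sx => // <-; rewrite (negbTE (S_irr _ _)).
have E1 : map_mx (horner_eval 0) \o path_ G G' = G by apply/funext=> k /=.
have E2 : map_mx (horner_eval 0) \o (C \o (invmx \o G)) = invmx \o G.
  by apply/funext=> k /=.
have [||d1 d1N0 d1P] := @row_full_deform I m S K (path_ G G') (C \o (invmx \o G)).
- by rewrite E1 E2 obs1.
- by rewrite E1 E2.
(* The adjugate replaces the inverse of the second path to stay polynomial; the constant factor
   makes [B k] equal to [invmx (G' k)] at 0. *)
pose B k : 'M[{poly K}]_m := ((\det (G' k))^-1)%:P *: \adj (path_ G' G k).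
have BE t k : map_mx (horner_eval t) (B k) =
    (\det (G' k))^-1 *: \adj (G' k + t *: (G k - G' k)).
  by rewrite map_mxZ map_mx_adj pathE /= /horner_eval hornerC.
have E3 : map_mx (horner_eval 0) \o (C \o G') = G' by apply/funext=> k /=.
have E4 : map_mx (horner_eval 0) \o B = invmx \o G'.
  by apply/funext=> k /=; rewrite BE scale0r addr0 /invmx uG'.
have [||d2 d2N0 d2P] := @row_full_deform I m S K (C \o G') B.
- by rewrite E3 E4 obs1.
- by rewrite E3 E4.
pose d3 := \prod_k \det (path_ G G' k).
have d3N0 : d3 != 0.
  apply/prodf_neq0=> k _; apply/eqP=> dk.
  have: horner_eval 0 (\det (path_ G G' k)) = \det (G k) by rewrite -det_map_mx path0.
  by rewrite dk rmorph0 => /esym/eqP; apply/negP; rewrite -unitfE -unitmxE.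
(* The second path starts at G' and so meets Z_t at parameter 1 - t, hence the substitution. The
   factor [d3] keeps Z_t invertible. *)
pose d := d1 * (d2 \Po (1 - 'X)) * d3.
have : d != 0.
  rewrite !mulf_neq0 //; apply: contraNneq d2N0 => d20.
  rewrite -[d2]comp_polyXr (_ : 'X = (1 - 'X) \Po (1 - 'X) :> {poly K}).
    by rewrite comp_polyA d20 comp_poly0.
  by rewrite comp_polyB comp_polyX -polyC1 comp_polyC opprB addrC subrK.
case/closed_nonrootP=> t; rewrite /root /d !hornerM horner_comp hornerD hornerN hornerX.
rewrite hornerC !mulf_eq0 !negb_or => /andP[/andP[/d1P[M1 uM1 M10] /d2P[M2 uM2 M20]] d3t].
exists (M2 *m M1); first by rewrite unitmx_mul uM2.
apply/eqP/obsP=> -[[k i] j] Sx /=.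
have /obsP zM1 := introT eqP M10.
have /obsP zM2 := introT eqP M20.
pose Z := G k + t *: (G' k - G k).
have detZ : \det Z != 0.
  have/prodf_neq0/(_ k isT) : \prod_k (\det (path_ G G' k)).[t] != 0.
    by rewrite -horner_prod.
  by rewrite -[_.[t]]/(horner_eval t _) -det_map_mx pathE.
pose X1 := Z *m M1 *m invmx (G k).
pose X2 := G' k *m M2 *m ((\det (G' k))^-1 *: \adj Z).
have X10 u v : S (k, u, v) -> X1 u v = 0.
  by move/zM1; rewrite /= pathE CE.
have X20 u v : S (k, u, v) -> X2 u v = 0.
  move/zM2; rewrite /= BE CE (_ : G' k + _ = Z) //.
  by rewrite /Z scalerBl scale1r -scalerN opprB addrA (addrC (G' k)) subrK.
have : (X2 *m X1) i j = 0.
  rewrite mxE big1 // => l _.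
  by case/orP: (S_split l Sx) => [/X20->|/X10->]; rewrite ?mul0r ?mulr0.
rewrite /X1 /X2 -!scalemxAr -!scalemxAl !mulmxA -[_ *m \adj Z *m Z]mulmxA mul_adj_mx.
rewrite mul_mx_scalar -!scalemxAl 2!mxE => /eqP.
rewrite !mulf_eq0 invr_eq0 (negbTE detZ) /=.
by have := uG' k; rewrite unitmxE unitfE => /negbTE-> /= /eqP.
Qed.

End Rigid.

(** * Filtrations in coordinates *)

Section Charts.
Variables (K : fieldType) (V : vectType K).
Implicit Types (U W : {vspace V}).

Section Coordinates.
Variable m : nat.
Implicit Types e b : m.-tuple V.

Definition crd e v : 'rV_m := \row_j coord e j v.

Lemma crd_is_linear e : linear (crd e).
Proof. by move=> a u v; apply/rowP=> j; rewrite !mxE linearP. Qed.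

HB.instance Definition _ e :=
  GRing.isLinear.Build K V 'rV[K]_m _ (crd e) (crd_is_linear e).

Definition of_crd e (x : 'rV_m) : V := \sum_j x 0 j *: e`_j.

Lemma crdK U e v : basis_of U e -> v \in U -> of_crd e (crd e v) = v.
Proof.
move=> eU vU; rewrite [RHS](coord_basis eU vU).
by apply: eq_bigr => j _; rewrite mxE.
Qed.

Lemma of_crdK U e x : basis_of U e -> crd e (of_crd e x) = x.
Proof.
move=> eU; apply/rowP=> j; rewrite mxE linear_sum (bigD1 j) //= big1 ?addr0 => [|i ij].
  by rewrite linearZ /= coord_free ?eqxx ?(basis_free eU) // mulr1.
by rewrite linearZ /= coord_free ?(basis_free eU) // (negbTE ij) mulr0.
Qed.

Lemma of_crd_mem U e x : basis_of U e -> of_crd e x \in U.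
Proof.
move=> eU; apply: memv_suml => j _; apply/memvZ/(basis_mem eU).
by rewrite mem_nth ?size_tuple.
Qed.

Lemma crd_inj U e : basis_of U e -> {in U &, injective (crd e)}.
Proof. by move=> eU u v uU vU uv; rewrite -(crdK eU uU) uv (crdK eU vU). Qed.

Definition crd_change b e : 'M_m := \matrix_i crd b e`_i.

Lemma crd_changeP U b e v : basis_of U b -> basis_of U e -> v \in U ->
  crd b v = crd e v *m crd_change b e.
Proof.
move=> bU eU vU; rewrite -{1}(crdK eU vU) linear_sum mulmx_sum_row.
by apply: eq_bigr => j _; rewrite linearZ rowK.
Qed.

Lemma crd_change_unit U b e : basis_of U b -> basis_of U e ->
  crd_change b e \in unitmx.
Proof.
move=> bU eU; suff: crd_change e b *m crd_change b e = 1%:M by case/mulmx1_unit.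
apply/row_matrixP=> i; rewrite row_mul rowK -(crd_changeP bU eU); last first.
  by apply: (basis_mem bU); rewrite mem_nth ?size_tuple.
apply/rowP=> j; rewrite !mxE coord_free ?(basis_free bU) //.
Qed.

End Coordinates.

(** Indexed by all naturals and constant from s on, so that flags of different lengths can share one
    s. *)
Record filtration (s : nat) (F : nat -> {vspace V}) : Prop := Filtration {
  filt0 : F 0%N = 0%VS;
  filt_mono : forall i j, (i <= j)%N -> (F i <= F j)%VS;
  filt_full : F s = fullv }.

Section OneFiltration.
Variables (s : nat) (F : nat -> {vspace V}).
Hypothesis filtF : filtration s F.

Lemma filt_ge i : (s <= i)%N -> F i = fullv.
Proof.
by move=> /(filt_mono filtF); rewrite (filt_full filtF) => le; apply/eqP; rewrite eqEsubv subvf.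
Qed.

(** Induction on the length: a basis of F t inside U is extended by a basis of a complement of it in
    F (t + 1) inside U. Initial segments of the resulting basis then span all the [F i :&: U] at
    once. *)
Lemma adapted_basis U m : \dim U = m ->
  exists2 e : m.-tuple V, basis_of U e & forall i v, v \in U ->
   (v \in F i <-> forall j : 'I_m, (\dim (F i :&: U) <= j)%N -> crd e v 0 j = 0).
Proof.
move=> dU.
have [X [XU Xtake]] : exists X, basis_of (F s :&: U) X /\
    forall i, (i <= s)%N -> basis_of (F i :&: U) (take (\dim (F i :&: U)) X).
  elim: s => [|t [X [XU Xtake]]].
    exists [::]; rewrite (filt0 filtF) cap0v nil_basis; split=> // i.
    by rewrite leqn0 => /eqP->; rewrite (filt0 filtF) cap0v nil_basis.
  pose Y : seq V := vbasis ((F t.+1 :&: U) :\: (F t :&: U)).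
  have YP : basis_of ((F t.+1 :&: U) :\: (F t :&: U)) Y by apply: vbasisP.
  have le : (F t :&: U <= F t.+1 :&: U)%VS by rewrite capvS ?(filt_mono filtF).
  have XYU : basis_of (F t.+1 :&: U) (X ++ Y).
    move: Y YP => Y YP; have := addv_diff (F t.+1 :&: U) (F t :&: U); rewrite (addv_idPl le) addvC => <-.
    by apply: cat_basis XU YP; apply/directv_addP; rewrite capvC capv_diff.
  exists (X ++ Y); split=> // i; rewrite leq_eqVlt => /predU1P[->|].
    by rewrite take_oversize // (size_basis (X := in_tuple (X ++ Y)) XYU).
  rewrite ltnS => it; rewrite takel_cat ?Xtake //.
  rewrite -(size_basis (X := in_tuple X) XU) dimvS // capvS //.
  exact: (filt_mono filtF).
have Fs : (F s :&: U)%VS = U by rewrite (filt_full filtF) capfv.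
rewrite Fs in XU.
have sX : size X == m by rewrite -dU (size_basis (X := in_tuple X) XU).
pose e := Tuple sX.
have take_e i : basis_of (F i :&: U) (take (\dim (F i :&: U)) e).
  have [/Xtake//|/ltnW si] := leqP i s.
  by rewrite (filt_ge si) -(filt_full filtF) Fs take_oversize // dU size_tuple.
have eU : basis_of U e by [].
exists e => // i v vU; set d := \dim _.
have dm : (d <= m)%N by rewrite -dU dimvS ?capvSr.
split=> [vF j dj|v0].
  have: v \in (F i :&: U)%VS by rewrite memv_cap vF.
  have := take_e i; rewrite -/d => be.
  rewrite -(span_basis be) => /(coord_span (X := in_tuple (take d e))) ->.
  rewrite linear_sum summxE big1 // => l _; rewrite linearZ mxE /= mxE.
  have ld : (l < d)%N by apply: leq_trans (ltn_ord l) _; rewrite size_take_min geq_minl.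
  rewrite nth_take // (_ : nat_of_ord l = Ordinal (leq_trans ld dm)) //.
  rewrite coord_free ?(basis_free eU) // -val_eqE /= (ltn_eqF (leq_trans ld dj)).
  by rewrite mulr0.
suff: v \in (F i :&: U)%VS by rewrite memv_cap => /andP[].
rewrite -(crdK eU vU); apply: memv_suml => j _.
have [jd|/v0->] := ltnP j d; last by rewrite scale0r mem0v.
apply/memvZ; rewrite -(span_basis (take_e i)); apply: memv_span.
by rewrite -/d -(nth_take _ jd) mem_nth // size_take_min size_tuple leq_min jd ltn_ord.
Qed.

(** The rows of [G] are the coordinates in [b] of an adapted basis of U; multiplying by [invmx G]
    gives adapted coordinates. *)
Definition chart1 U m (b : m.-tuple V) (G : 'M_m) :=
  G \in unitmx /\ forall i v, v \in U ->
   (v \in F i <-> forall j : 'I_m, (\dim (F i :&: U) <= j)%N ->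
      (crd b v *m invmx G) 0 j = 0).

Lemma chart1_exists U m (b : m.-tuple V) : basis_of U b -> exists G, chart1 U b G.
Proof.
move=> bU; have [e eU eF] := adapted_basis (size_basis bU).
have uG := crd_change_unit bU eU.
exists (crd_change b e); split=> // i v vU; rewrite (eF i v vU).
by rewrite (crd_changeP bU eU vU) mulmxK.
Qed.

End OneFiltration.

Definition fmor1 (F : nat -> {vspace V}) U (F' : nat -> {vspace V}) U' (f : 'End(V)) :=
  forall i v, v \in F i -> v \in U -> f v \in F' i /\ f v \in U'.

(** Row i of [G *m M *m invmx G'] holds the adapted coordinates of the image of the i-th adapted
    basis vector, which lies in F t exactly when i is below the dimension of [F t :&: U]. Equal
    dimensions give source and target the same blocks. *)
Lemma fmor1P s F U F' U' m (b b' : m.-tuple V) G G' (f : 'End(V)) M :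
    filtration s F -> filtration s F' ->
    basis_of U b -> basis_of U' b' -> chart1 F U b G -> chart1 F' U' b' G' ->
    (forall i, (i <= s)%N -> \dim (F i :&: U) = \dim (F' i :&: U')) ->
    (forall v, v \in U -> f v \in U' /\ crd b' (f v) = crd b v *m M) ->
  fmor1 F U F' U' f <->
  (forall (t : 'I_s.+1) (i j : 'I_m), (i < \dim (F t :&: U) <= j)%N ->
     (G *m M *m invmx G') i j = 0).
Proof.
move=> filtF filtF' bU bU' [uG chF] [uG' chF'] eqD fM; split=> [morf t i j ij|M0 i v vF vU].
  pose v := of_crd b (row i G).
  have vU : v \in U by apply: of_crd_mem bU.
  have [fvU' fv] := fM v vU.
  have crdv : crd b v *m invmx G = delta_mx 0 i.
    by rewrite (of_crdK _ bU) -row_mul mulmxV // row1.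
  have vF : v \in F t.
    apply/(chF t v vU) => l dl; rewrite crdv mxE eqxx /=; case: eqP => // il.
    by move: ij dl; rewrite il; lia.
  have [/(chF' t _ fvU') + _] := morf t v vF vU.
  have ts : (t <= s)%N by rewrite -ltnS.
  rewrite -(eqD _ ts) => /(_ j); rewrite fv (of_crdK _ bU) -row_mul -row_mul mxE.
  by apply; case/andP: ij.
have [fvU' fv] := fM v vU; split=> //; apply/(chF' i _ fvU') => l.
have [is_|/ltnW si] := leqP i s; last first.
  rewrite (filt_ge filtF' si) capfv (size_basis bU') => /leq_gtF.
  by rewrite ltn_ord.
rewrite fv -eqD // => dl; have /(chF i v vU) v0 := vF.
have -> : crd b v *m M *m invmx G' = crd b v *m invmx G *m (G *m M *m invmx G').
  by rewrite !mulmxA mulmxKV.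
rewrite mxE big1 // => j _.
have [jd|/v0->] := ltnP j (\dim (F i :&: U)); last by rewrite mul0r.
have it : (i < s.+1)%N by [].
by rewrite (M0 (Ordinal it)) ?mulr0 //= jd.
Qed.

Section MatrixMap.
Variables (m : nat) (b b' : m.-tuple V).

Definition mxmap_fun (M : 'M_m) v := of_crd b' (crd b v *m M).

Lemma mxmap_is_linear M : linear (mxmap_fun M).
Proof.
move=> a u v; rewrite /mxmap_fun linearP mulmxDl -scalemxAl /of_crd scaler_sumr -big_split /=.
by apply: eq_bigr => j _; rewrite !mxE scalerDl scalerA.
Qed.

HB.instance Definition _ M :=
  GRing.isLinear.Build K V V _ (mxmap_fun M) (mxmap_is_linear M).

Definition mxmap M : 'End(V) := linfun (mxmap_fun M).

Lemma mxmapP U' M v : basis_of U' b' ->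
  mxmap M v \in U' /\ crd b' (mxmap M v) = crd b v *m M.
Proof.
by move=> bU'; rewrite lfunE; split; [apply: of_crd_mem | apply: of_crdK bU'].
Qed.

Lemma mxmap_onto U U' (f : 'End(V)) : basis_of U b -> basis_of U' b' ->
  (forall v, v \in U -> f v \in U') ->
  exists M, forall v, v \in U -> f v \in U' /\ crd b' (f v) = crd b v *m M.
Proof.
move=> bU bU' fU; exists (\matrix_i crd b' (f b`_i)) => v vU; split; first exact: fU.
rewrite -{1}(crdK bU vU) linear_sum linear_sum mulmx_sum_row.
by apply: eq_bigr => j _; rewrite !linearZ rowK.
Qed.

End MatrixMap.

End Charts.

(** * Counting the entries that block triangularity forces to vanish *)

Section Counting.
Local Open Scope nat_scope.

(** A nondecreasing [D] cuts the indices into blocks [D t, D (t + 1)); the test says that the block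
    of i strictly precedes that of j. *)
Definition jump s (D : nat -> nat) (i j : nat) : bool :=
  [exists t : 'I_s.+1, i < D t <= j].

Lemma sum_ord_interval m a b : a <= b <= m -> \sum_(i < m) (a <= i < b) = b - a.
Proof.
move=> abm; have -> : b - a = minn b m - a by lia.
elim: m {abm} => [|k IHk]; first by rewrite big_ord0; lia.
rewrite big_ord_recr /= IHk; case: (boolP (a <= k < b)) => /=; lia.
Qed.

Variables (s m : nat) (D : nat -> nat).
Hypotheses (D0 : D 0 = 0) (Dm : D s = m).
Hypothesis D_mono : forall i j, i <= j -> D i <= D j.

Lemma jump_block (i : 'I_m) : exists c : 'I_s, D c <= i < D c.+1.
Proof.
have ex : exists t, i < D t by exists s; rewrite Dm.
case: (ex_minnP ex) => -[|t]; first by rewrite D0.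
move=> it tmin; have ts : t < s by apply: tmin; rewrite Dm.
exists (Ordinal ts); rewrite it andbT /= leqNgt; apply/negP=> /tmin; lia.
Qed.

(** Each of the m^2 pairs of indices lies in one block, or in two blocks in one of two orders;
    transposition exchanges the two orders. *)
Lemma sum_jump :
  (\sum_(i < m) \sum_(j < m) jump s D i j).*2 + \sum_(t < s) (D t.+1 - D t) ^ 2 = m ^ 2.
Proof.
have [c cP] := choice jump_block.
have D_lt i j k : D i <= k < D j -> i < j.
  case/andP=> ik kj; rewrite ltnNge; apply/negP=> /D_mono.
  by rewrite leqNgt (leq_ltn_trans ik kj).
have cE (i : 'I_m) (t : 'I_s) : (D t <= i < D t.+1) = (c i == t).
  have /andP[ci1 ci2] := cP i; apply/idP/eqP => [/andP[it1 it2]|<-]; last by rewrite ci1.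
  apply/val_inj/eqP; rewrite /= eqn_leq -ltnS -[X in _ && X]ltnS.
  by rewrite (D_lt _ _ i) ?ci1 // (D_lt _ _ i) ?it1.
have jE (i j : 'I_m) : jump s D i j = (c i < c j).
  have /andP[ci1 ci2] := cP i; have /andP[cj1 cj2] := cP j.
  apply/existsP/idP => [[t] /andP[it tj]|lt].
    apply: (@leq_trans t); first by apply: (D_lt _ _ i); rewrite ci1.
    by rewrite -ltnS; apply: (D_lt _ _ j); rewrite tj.
  have le : (c i).+1 < s.+1 by rewrite ltnS.
  by exists (Ordinal le); rewrite ci2 (leq_trans (D_mono lt) cj1).
have -> : \sum_(t < s) (D t.+1 - D t) ^ 2 = \sum_(i < m) \sum_(j < m) (c i == c j).
  transitivity (\sum_(t < s) \sum_(i < m) \sum_(j < m) ((c i == t) && (c j == t))).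
    apply: eq_bigr => t _; rewrite -(@sum_ord_interval m); last first.
      by rewrite D_mono //= -Dm D_mono.
    rewrite expnS expn1 big_distrl /=; apply: eq_bigr => i _.
    by rewrite big_distrr /=; apply: eq_bigr => j _; rewrite !cE mulnb.
  rewrite exchange_big; apply: eq_bigr => i _; rewrite exchange_big; apply: eq_bigr => j _ /=.
  rewrite (bigD1 (c i)) //= big1 ?addn0 => [|t]; first by rewrite eqxx eq_sym.
  by rewrite eq_sym => /negbTE->.
have sw : \sum_(i < m) \sum_(j < m) jump s D i j = \sum_(i < m) \sum_(j < m) jump s D j i.
  by rewrite exchange_big.
rewrite -addnn [X in _ + X + _]sw -!big_split /=.
transitivity (\sum_(i < m) \sum_(j < m) 1); last by rewrite !sum_nat_const !card_ord muln1.
apply: eq_bigr => i _; rewrite -!big_split /=; apply: eq_bigr => j _.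
by rewrite !jE -val_eqE /=; case: ltngtP.
Qed.

End Counting.

(** * Bricks and rigid subobjects *)

Section Objects.
Variables (K : closedFieldType) (V : vectType K) (I : finType) (s : nat).
Implicit Types (U W : {vspace V}) (F : I -> nat -> {vspace V}).
Implicit Types (f g e h : 'End(V)).

(** Maps between subobjects are represented by endomorphisms of all of V, so equations between them
    are imposed on U alone. *)
Definition fmor F U F' U' f := forall k, fmor1 (F k) U (F' k) U' f.
Definition fendo F U f := fmor F U F U f.
Definition fidem F U e := fendo F U e /\ {in U, forall v, e (e v) = e v}.
Definition indec F U := U != 0%VS /\ forall e, fidem F U e ->
  {in U, forall v, e v = 0} \/ {in U, forall v, e v = v}.
Definition brick F U := forall f, fendo F U f ->
  exists c, {in U, forall v, f v = c *: v}.

(* The vanishing of Ext^1(U, U). *)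
Definition rigid F U := forall h : I -> 'End(V),
  (forall k, {in U, forall v, h k v \in U}) ->
  exists h0, forall k, fmor1 (F k) U (F k) U (h0 - h k).

Definition dims F U k t : nat := \dim (F k t :&: U).
Definition jumps m (D : I -> nat -> nat) : pred (I * 'I_m * 'I_m) :=
  fun x => jump s (D x.1.1) x.1.2 x.2.

(* Positivity of the Tits form at the dimension vector of U, doubled. *)
Definition tits_pos F U :=
  (\dim U ^ 2 < \sum_k \sum_(t < s) (dims F U k t.+1 - dims F U k t) ^ 2)%N.

Lemma jumps_irr m D k i : ~~ jumps (m := m) D (k, i, i).
Proof. by apply/negP=> /existsP[t] /=; lia. Qed.

Lemma jumps_split m D k i j l :
  jumps (m := m) D (k, i, j) -> jumps D (k, i, l) || jumps D (k, l, j).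
Proof.
move=> /existsP[t] /= ij; have [lt|le] := ltnP l (D k t); apply/orP; [right|left];
by apply/existsP; exists t => /=; lia.
Qed.

Section Filtered.
Variable F : I -> nat -> {vspace V}.
Hypothesis filtF : forall k, filtration s (F k).

Lemma chart_exists U m (b : m.-tuple V) : basis_of U b ->
  exists G, forall k, chart1 (F k) U b (G k).
Proof.
move=> bU; have ex k := chart1_exists (filtF k) bU.
by have [G chG] := choice ex; exists G.
Qed.

Lemma dims0 U k : dims F U k 0 = 0%N.
Proof. by rewrite /dims (filt0 (filtF k)) cap0v dimv0. Qed.

Lemma dims_full U k : dims F U k s = \dim U.
Proof. by rewrite /dims (filt_full (filtF k)) capfv. Qed.

Lemma dims_mono U k i j : (i <= j)%N -> (dims F U k i <= dims F U k j)%N.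
Proof. by move=> ij; rewrite dimvS // capvS // (filt_mono (filtF k)). Qed.

(** Summing [sum_jump] over the three filtrations gives 2 |S| plus the squared jumps equal to 3 m^2,
    and by positivity the squares exceed m^2. *)
Lemma card_jumps U : #|I| = 3 -> tits_pos F U ->
  (#|@jumps (\dim U) (dims F U)| < \dim U * \dim U)%N.
Proof.
rewrite /tits_pos => I3 posU; set m := \dim U in posU *.
have -> : #|@jumps m (dims F U)| =
    (\sum_k \sum_(i < m) \sum_(j < m) jump s (dims F U k) i j)%N.
  rewrite -sum1_card big_mkcond /=.
  rewrite pair_big /= pair_big /=; apply: eq_bigr => -[[k i] j] _.
  by rewrite unfold_in /jumps /=; case: jump.
have : (\sum_k ((\sum_(i < m) \sum_(j < m) jump s (dims F U k) i j).*2 +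
         \sum_(t < s) (dims F U k t.+1 - dims F U k t) ^ 2) = \sum_(k : I) m ^ 2)%N.
  apply: eq_bigr => k _; apply: sum_jump; first exact: dims0.
    exact: dims_full.
  by move=> i j; apply: dims_mono.
rewrite big_split /= sum_nat_const I3.
rewrite (eq_bigr (fun k => 2 * (\sum_(i < m) \sum_(j < m) jump s (dims F U k) i j)))%N.
  by rewrite -big_distrr /= -mulnn in posU *; lia.
by move=> k _; rewrite mul2n.
Qed.

End Filtered.

Section TwoObjects.
Variables F F' : I -> nat -> {vspace V}.
Hypothesis filtF : forall k, filtration s (F k).
Hypothesis filtF' : forall k, filtration s (F' k).
Variables (U U' : {vspace V}) (m : nat) (b b' : m.-tuple V).
Hypotheses (bU : basis_of U b) (bU' : basis_of U' b').
Variables G G' : I -> 'M[K]_m.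
Hypotheses (chG : forall k, chart1 (F k) U b (G k)).
Hypotheses (chG' : forall k, chart1 (F' k) U' b' (G' k)).
Hypothesis eqD : forall k t, (t <= s)%N -> dims F U k t = dims F' U' k t.

Lemma fmor_obs f M :
    {in U, forall v, f v \in U' /\ crd b' (f v) = crd b v *m M} ->
  fmor F U F' U' f <-> obs (jumps (dims F U)) G (invmx \o G') M == 0.
Proof.
move=> fM.
have P k := fmor1P (filtF k) (filtF' k) bU bU' (chG k) (chG' k) (eqD k) fM.
split=> [morf|/obsP M0].
  apply/obsP=> -[[k i] j] /existsP[t] /= ij.
  by have /P/(_ t i j) := morf k; apply.
move=> k; apply/P => t i j ij.
by apply: (M0 (k, i, j)); apply/existsP; exists t.
Qed.

End TwoObjects.

Lemma brick_rigid_obs F U m (b : m.-tuple V) G : #|I| = 3 ->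
    (forall k, filtration s (F k)) -> basis_of U b -> (forall k, chart1 (F k) U b (G k)) ->
    tits_pos F U -> brick F U -> rigid_mx (jumps (m := m) (dims F U)) G.
Proof.
move=> I3 filtF bU chG posU brickU; have dU := size_basis bU.
apply: brick_rigid_mx => [M M0|]; last first.
  by have := card_jumps filtF I3 posU; rewrite dU.
have fM : {in U, forall v, mxmap b b M v \in U /\ crd b (mxmap b b M v) = crd b v *m M}.
  by move=> v _; apply: mxmapP.
have [c fc] : exists c, {in U, forall v, mxmap b b M v = c *: v}.
  by apply: brickU; apply/(fmor_obs filtF filtF bU bU chG chG _ fM) => //; apply/eqP.
exists c; apply/row_matrixP=> i; rewrite !rowE.
have vU := of_crd_mem (delta_mx 0 i) bU.
have [_] := fM _ vU; rewrite fc // linearZ /= !(of_crdK _ bU) => <-.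
by rewrite mul_mx_scalar.
Qed.

(** One matrix M is chosen whose observed entries at every k agree with those of [h k]; the
    difference is then filtered for [F k]. *)
Lemma rigid_of_obs F U m (b : m.-tuple V) G : (forall k, filtration s (F k)) ->
    basis_of U b -> (forall k, chart1 (F k) U b (G k)) ->
  rigid_mx (jumps (m := m) (dims F U)) G -> rigid F U.
Proof.
move=> filtF bU chG rG h hU.
have exN k := mxmap_onto bU bU (hU k).
have [N hN] := choice exN.
pose S := jumps (m := m) (dims F U).
pose y : 'rV_#|S| := \row_x let z := enum_val x in
  (G z.1.1 *m N z.1.1 *m invmx (G z.1.1)) z.1.2 z.2.
have [M My] := rigid_mx_solve y rG.
exists (mxmap b b M) => k.
have fM : {in U, forall v, (mxmap b b M - h k) v \in U /\
    crd b ((mxmap b b M - h k) v) = crd b v *m (M - N k)}.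
  move=> v vU; have [f1 f2] := mxmapP b M v bU; have [g1 g2] := hN k v vU.
  by rewrite add_lfunE opp_lfunE memvB // linearB /= f2 g2 mulmxBr.
apply/(fmor1P (filtF k) (filtF k) bU bU (chG k) (chG k) _ fM) => // t i j ij.
have Sx : S (k, i, j) by apply/existsP; exists t.
have /rowP/(_ (enum_rank_in Sx (k, i, j))) := My.
rewrite obsE mxE /= enum_rankK_in //= => eqMN.
by rewrite mulmxBr mulmxBl mxE [X in _ + X]mxE eqMN subrr.
Qed.

Lemma brick_rigid F U : #|I| = 3 -> (forall k, filtration s (F k)) ->
  tits_pos F U -> brick F U -> rigid F U.
Proof.
move=> I3 filtF posU brU; have bU := vbasisP U.
have [G chG] := chart_exists filtF bU.
exact: rigid_of_obs bU chG (brick_rigid_obs I3 filtF bU chG posU brU).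
Qed.

Lemma bricks_iso F F' U U' : #|I| = 3 ->
    (forall k, filtration s (F k)) -> (forall k, filtration s (F' k)) ->
    tits_pos F U -> tits_pos F' U' -> brick F U -> brick F' U' ->
    (forall k t, (t <= s)%N -> dims F U k t = dims F' U' k t) ->
    \dim U = \dim U' ->
  exists2 f, fmor F U F' U' f & {in U, forall v, f v = 0 -> v = 0}.
Proof.
move=> I3 filtF filtF' posU posU' brU brU' eqD eqd.
have bU := vbasisP U.
have [b' bU'] : exists b' : (\dim U).-tuple V, basis_of U' b'.
  by rewrite eqd; exists (vbasis U'); apply: vbasisP.
set b := vbasis U in bU.
have [G chG] := chart_exists filtF bU; have [G' chG'] := chart_exists filtF' bU'.
have rG := brick_rigid_obs I3 filtF bU chG posU brU.
have rG' := brick_rigid_obs I3 filtF' bU' chG' posU' brU'.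
have eqS : jumps (m := \dim U) (dims F' U') = jumps (dims F U).
  apply/funext=> -[[k i] j]; apply: eq_existsb => t /=.
  by rewrite eqD // -ltnS.
rewrite eqS in rG'.
have [||M uM M0] := @rigid_mx_unique K I _ _ (@jumps_irr _ _) (@jumps_split _ _) G' G _ _ rG' rG.
- by move=> k; have [] := chG' k.
- by move=> k; have [] := chG k.
have fM : {in U, forall v, mxmap b b' M v \in U' /\ crd b' (mxmap b b' M v) = crd b v *m M}.
  by move=> v _; apply: mxmapP.
exists (mxmap b b' M).
  by apply/(fmor_obs filtF filtF' bU bU' chG chG' eqD fM); apply/eqP.
move=> v vU fv0; have [_] := fM v vU; rewrite fv0 linear0 => /esym M0v.
apply: (crd_inj bU) => //; first exact: mem0v.
by rewrite linear0 -[LHS](mulmxK uM) M0v mul0mx.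
Qed.

End Objects.

(** * Indecomposables are bricks *)

Lemma ex_min_measure (T : Type) (P : T -> Prop) (mu : T -> nat) :
  (exists x, P x) -> exists2 x, P x & forall y, P y -> (mu x <= mu y)%N.
Proof.
case=> x; elim/ltn_ind: {x}(mu x) {-2}x (erefl (mu x)) => n IHn x xn Px.
have [[y yn Py]|min_x] := pselect (exists2 y, (mu y < mu x)%N & P y).
  by apply: (IHn (mu y)) (erefl _) Py; rewrite -xn.
by exists x => // y Py; rewrite leqNgt; apply/negP=> lt; apply: min_x; exists y.
Qed.

Section LinearMaps.
Variables (K : fieldType) (V : vectType K).
Implicit Types (U W : {vspace V}) (f g e h : 'End(V)).

Definition fpow f n : 'End(V) := iter n (comp_lfun f) \1%VF.

Lemma fpowE f n v : fpow f n v = iter n f v.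
Proof. by elim: n => [|n IHn] /=; rewrite ?id_lfunE // comp_lfunE IHn. Qed.

Lemma daddv_pi_0 U W v : (U :&: W = 0)%VS -> v \in W -> daddv_pi U W v = 0.
Proof.
move=> UW vW; have WU : (W :&: U = 0)%VS by rewrite capvC.
have := daddv_pi_add UW (subvP (addvSr U W) _ vW).
by rewrite (daddv_pi_id WU) // => /eqP; rewrite -subr_eq0 addrK => /eqP.
Qed.

Lemma lfun_factor U (f g : 'End(V)) : {in U, forall v, f v = 0 -> g v = 0} ->
  exists h : 'End(V), {in U, forall v, g v = h (f v)}.
Proof.
move=> fg; pose fU := (f \o projv U)%VF; pose sec := (projv U \o fU^-1)%VF.
exists (g \o sec)%VF => v vU; rewrite comp_lfunE.
have fv : f v \in limg fU by rewrite -{1}(projv_id vU) -comp_lfunE memv_img ?memvf.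
have := limg_lfunVK fv; rewrite {1}comp_lfunE => fsec.
have secU : sec (f v) \in U by rewrite comp_lfunE memv_proj.
apply/eqP; rewrite -subr_eq0 -linearB /=; apply/eqP/fg; first exact: memvB.
by rewrite linearB /= [X in _ - f X]comp_lfunE fsec subrr.
Qed.

Lemma lfun_section U (f : 'End(V)) : (f @: U <= U)%VS -> (U :&: lker f = 0)%VS -> (f @: U)%VS = U.
Proof. by move=> fU f0; apply/eqP; rewrite eqEdim fU (limg_dim_eq f0) /=. Qed.

(** A single filtration has no extensions. The complement C of N grows stepwise: step t + 1 adds a
    complement of [W] in F (t + 1) inside U. The projection to N along C then respects every F i. *)
Lemma filtration_split s (F : nat -> {vspace V}) N U : filtration s F -> (N <= U)%VS ->
  exists2 r, fmor1 F U F N r & {in N, forall v, r v = v}.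
Proof.
move=> filtF NU.
have [C [_ CN CF]] : exists C : {vspace V}, [/\ (C <= F s :&: U)%VS, (C :&: N = 0)%VS &
    forall i, (i <= s)%N -> (F i :&: U <= (F i :&: N) + C)%VS].
  elim: s {filtF} (filt0 filtF) (filt_mono filtF) => [|t IHt] F0 Fm.
    exists 0%VS; rewrite cap0v sub0v; split=> // i; rewrite leqn0 => /eqP->.
    by rewrite F0 cap0v sub0v.
  have [C [CU CN CF]] := IHt F0 Fm.
  pose T := (F t.+1 :&: U)%VS; pose W := ((F t.+1 :&: N) + (F t :&: U))%VS.
  have tT : (F t :&: U <= T)%VS by rewrite capvS // Fm.
  exists (C + (T :\: W))%VS; split.
  - by rewrite subv_add (subv_trans CU tT) diffvSl.
  - apply/eqP; rewrite -subv0; apply/subvP=> x.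
    rewrite memv_cap => /andP[/memv_addP[c cC [d dD xE]] xN].
    have dT := subvP (diffvSl T W) d dD; have cT := subvP (subv_trans CU tT) c cC.
    have xW : x \in W.
      apply: (subvP (addvSl _ _)); rewrite memv_cap xN andbT xE.
      by apply: memvD; [move: cT | move: dT]; rewrite memv_cap => /andP[].
    have cW : c \in W by apply: (subvP (subv_trans CU (addvSr _ _))).
    have : d \in ((T :\: W) :&: W)%VS.
      by rewrite memv_cap dD -(addKr c d) -xE addrC memvB.
    rewrite capv_diff memv0 => /eqP d0; move: xE; rewrite d0 addr0 => xc.
    by rewrite -CN memv_cap xN xc cC.
  move=> i; rewrite leq_eqVlt => /predU1P[->|]; last first.
    by rewrite ltnS => /CF/subv_trans->//; rewrite addvS // addvSl.
  apply: (@subv_trans _ _ (T + W)%VS); first exact: addvSl.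
  rewrite -addv_diff subv_add; apply/andP; split.
    by rewrite addvA addvSr.
  rewrite subv_add addvSl (subv_trans (CF t (leqnn t))) // addvS ?addvSl //.
  by rewrite capvS // Fm.
exists (daddv_pi N C) => [i v vF vU|v vN]; last by rewrite daddv_pi_id // capvC.
split; last exact: memv_pi.
have {vF}: v \in (F i :&: U)%VS by rewrite memv_cap vF.
have [/CF/subvP sub|/ltnW si] := leqP i s; last first.
  by rewrite (filt_ge filtF si) memvf.
move/sub/memv_addP=> [n nFN [c cC ->]]; rewrite linearD /=.
have NC : (N :&: C = 0)%VS by rewrite capvC.
rewrite (daddv_pi_0 NC cC) addr0 daddv_pi_id //; first by case/memv_capP: nFN.
by case/memv_capP: nFN.
Qed.

End LinearMaps.

Lemma eigenvector_exists (K : closedFieldType) (V : vectType K) (U : {vspace V}) (f : 'End(V)) :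
    U != 0%VS -> {in U, forall v, f v \in U} ->
  exists c v, [/\ v \in U, v != 0 & f v = c *: v].
Proof.
move=> U0 fU; have bU := vbasisP U; have [M fM] := mxmap_onto bU bU fU.
have dU : \dim U != 0%N by rewrite dimv_eq0.
have [c] : exists c, root (char_poly M) c.
  by apply/closed_rootP; rewrite size_char_poly; case: (\dim U) dU.
rewrite -eigenvalue_root_char => /eigenvalueP[x xM x0].
have vU := of_crd_mem x bU.
exists c, (of_crd (vbasis U) x); split=> //.
  by apply: contraNneq x0 => v0; rewrite -(of_crdK x bU) v0 linear0.
have [fvU fv] := fM _ vU; apply: (crd_inj bU) => //; first exact: memvZ.
by rewrite fv linearZ /= !(of_crdK _ bU).
Qed.

(** * Fitting's lemma and Ringel's argument *)

Section Ringel.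
Variables (K : closedFieldType) (V : vectType K) (I : finType) (s : nat).
Implicit Types (U W N : {vspace V}) (f g e h : 'End(V)).
Variable F : I -> nat -> {vspace V}.
Hypothesis filtF : forall k, filtration s (F k).

Lemma fmor_comp F1 F2 F3 U1 U2 U3 f g :
  @fmor K V I F2 U2 F3 U3 f -> fmor F1 U1 F2 U2 g -> fmor F1 U1 F3 U3 (f \o g)%VF.
Proof.
move=> mf mg k i v vF vU; rewrite comp_lfunE.
by have [/mf gF gU] := mg k i v vF vU; apply: gF.
Qed.

Lemma fmorB F1 F2 U1 U2 f g :
  @fmor K V I F1 U1 F2 U2 f -> fmor F1 U1 F2 U2 g -> fmor F1 U1 F2 U2 (f - g).
Proof.
move=> mf mg k i v vF vU; rewrite add_lfunE opp_lfunE.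
by have [? ?] := mf k i v vF vU; have [? ?] := mg k i v vF vU; split; apply: memvB.
Qed.

Lemma fendoZ1 U c : fendo F U (c *: \1%VF).
Proof. by move=> k i v vF vU; rewrite scale_lfunE id_lfunE; split; apply: memvZ. Qed.

Lemma fendo1 U : fendo F U \1%VF.
Proof. by move=> k i v; rewrite id_lfunE. Qed.

Lemma fendo_fpow U f n : fendo F U f -> fendo F U (fpow f n).
Proof. by move=> ef; elim: n => [|n IHn] /=; [apply: fendo1 | apply: fmor_comp ef IHn]. Qed.

Hypothesis I0 : I.

Lemma fmor_sub F2 U U2 f : fmor F U F2 U2 f -> {in U, forall v, f v \in U2}.
Proof.
move=> mf v vU.
by have [] := mf I0 s v _ vU; rewrite ?(filt_full (filtF I0)) ?memvf.
Qed.

Lemma fidem_compl U e : fidem F U e -> fidem F U (\1 - e)%VF.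
Proof.
case=> ee idem_e; split=> [|v vU]; first exact: fmorB (@fendo1 U) ee.
rewrite !add_lfunE !opp_lfunE !id_lfunE linearB /= idem_e // subrr subr0 //.
Qed.

Lemma fidem_fix U e v : fidem F U e -> v \in (e @: U)%VS -> e v = v.
Proof. by case=> _ idem_e /memv_imgP[w wU ->]; apply: idem_e. Qed.

Lemma fidem_img U e : fidem F U e -> (e @: U <= U)%VS.
Proof. by case=> ee _; apply/subvP=> _ /memv_imgP[w /(fmor_sub ee) ? ->]. Qed.

(** Fitting's lemma. A power h of f of minimal rank is injective on its image, hence on the image of
    each [F k i :&: U]. So U splits into the kernel and the image of h compatibly with all
    filtrations, and the projection to the kernel is 0 or 1. *)
Lemma indec_inj_or_nilp U f : indec F U -> fendo F U f ->
  {in U, forall v, f v = 0 -> v = 0} \/ exists n, {in U, forall v, iter n f v = 0}.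
Proof.
move=> [U0 indU] ef.
have [n _ n_min] := @ex_min_measure nat (fun=> True) (fun n => \dim (fpow f n.+1 @: U)) (ex_intro _ 0%N Logic.I).
(* The exponent is positive, so the kernel of f lies in the kernel of h. *)
pose h := fpow f n.+1; pose hU := (h @: U)%VS.
have eh : fendo F U h by apply: fendo_fpow.
have hh : (h \o h)%VF = fpow f (n.+1 + n).+1.
  by apply/lfunP=> v; rewrite comp_lfunE !fpowE -iterD addnS.
have hU_ker : (hU :&: lker h = 0)%VS.
  have := limg_ker_dim h hU; rewrite -limg_comp hh.
  by have := n_min (n.+1 + n)%N Logic.I; rewrite -/h -/hU => le eqd; apply/eqP; rewrite -dimv_eq0; lia.
have decomp k i v : v \in F k i -> v \in U -> exists w, [/\ w \in F k i, w \in U & h v = h (h w)].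
  move=> vF vU; pose A := (F k i :&: U)%VS.
  have hA : (h @: A <= A)%VS.
    apply/subvP=> _ /memv_imgP[w /memv_capP[wF wU] ->].
    by have [? ?] := eh k i w wF wU; rewrite memv_cap; apply/andP.
  have hAK : (h @: A :&: lker h = 0)%VS.
    apply/eqP; rewrite -subv0 -hU_ker capvS // limgS //; exact: capvSr.
  have : h v \in (h @: A)%VS by rewrite memv_img // memv_cap vF.
  rewrite -{1}(lfun_section (limgS h hA) hAK) => /memv_imgP[_ /memv_imgP[w + ->] ->].
  by case/memv_capP=> ? ?; exists w.
pose Z := (U :&: lker h)%VS.
have ZhU : (Z :&: hU = 0)%VS.
  by apply/eqP; rewrite -subv0 -hU_ker [X in (X <= _)%VS]capvC capvS // capvSr.
pose e := daddv_pi Z hU.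
have eE k i v : v \in F k i -> v \in U -> exists w, [/\ w \in F k i, w \in U, e v = w & h w = 0].
  move=> vF vU; have [w [wF wU hv]] := decomp k i v vF vU.
  have [hwF hwU] := eh k i w wF wU.
  have v'Z : v - h w \in Z by rewrite memv_cap memvB // memv_ker linearB /= hv subrr eqxx.
  exists (v - h w); split; try exact: memvB; last by rewrite linearB /= hv subrr.
  rewrite -[in LHS](subrK (h w) v) linearD /= (daddv_pi_id ZhU v'Z).
  by rewrite (daddv_pi_0 ZhU) ?addr0 // memv_img.
have idem_e : fidem F U e.
  split=> [k i v vF vU|v _]; last exact: daddv_pi_proj.
  by have [w [? ? -> _]] := eE k i v vF vU.
have [e0|e1] := indU e idem_e.
  left=> v vU fv; have vZ : v \in Z.
    by rewrite memv_cap vU memv_ker fpowE iterSr fv -fpowE linear0 eqxx.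
  by rewrite -(daddv_pi_id ZhU vZ) [LHS]e0.
right; exists n.+1 => v vU; rewrite -fpowE -/h -(e1 v vU).
have vF : v \in F I0 s by rewrite (filt_full (filtF I0)) memvf.
by have [w [_ _ -> ->]] := eE I0 s v vF vU.
Qed.

(** Induction on the dimension: for a nontrivial idempotent e, one of e and 1 - e does not kill v,
    and its image is smaller. The vector v is tracked because [indec_brick] needs a summand that
    does not kill a given vector. *)
Lemma indec_summand U v : v \in U -> v != 0 ->
  exists e, [/\ fidem F U e, indec F (e @: U) & e v != 0].
Proof.
elim/ltn_ind: {U}(\dim U) {-2}U (erefl (\dim U)) v => d IHd U dU v vU v0.
have step e1 : fidem F U e1 -> ~ {in U, forall v, e1 v = v} -> e1 v != 0 ->
    exists e, [/\ fidem F U e, indec F (e @: U) & e v != 0].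
  move=> ide1 e1n1 e1v; pose U1 := (e1 @: U)%VS; have [ee1 _] := ide1.
  have ltU1 : (\dim U1 < d)%N.
    rewrite -dU ltn_neqAle dimvS ?fidem_img // andbT; apply/negP=> /eqP eqd.
    have U1U : U1 = U by apply/eqP; rewrite eqEdim fidem_img // eqd leqnn.
    by apply: e1n1 => w wU; apply: (fidem_fix ide1); rewrite -/U1 U1U.
  have [//|e2 [ide2 ind2 e2v]] := IHd _ ltU1 U1 (erefl _) (e1 v) (memv_img _ vU).
  have [ee2 id2] := ide2; have sub1 := subvP (fidem_img ide1).
  exists (e2 \o e1)%VF; split; [|by rewrite limg_comp|by rewrite comp_lfunE].
  split=> [k i w wF wU|w wU]; rewrite !comp_lfunE.
    have [e1F e1U] := ee1 k i w wF wU.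
    by have [? /sub1] := ee2 k i (e1 w) e1F (memv_img _ wU).
  have e1w := memv_img e1 wU.
  by rewrite (fidem_fix ide1 (fmor_sub ee2 e1w)) id2.
have U0 : U != 0%VS by apply: contraNneq v0 => U0; rewrite -memv0 -U0.
have [indU|] := pselect (indec F U).
  exists \1%VF; rewrite lim1g id_lfunE; split=> //; split; first exact: fendo1.
  by move=> w _; rewrite !id_lfunE.
move=> nind; have [e [ide en0 en1]] : exists e, [/\ fidem F U e,
    ~ {in U, forall v, e v = 0} & ~ {in U, forall v, e v = v}].
  apply: contrapT => nex; apply: nind; split=> // e ide.
  by apply: contrapT => /not_orP[? ?]; apply: nex; exists e.
have [ev0|] := eqVneq (e v) 0; last exact: step.
apply: (step (\1 - e)%VF); first exact: fidem_compl.
  move=> e'1; apply: en0 => w wU; have := e'1 w wU.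
  by rewrite add_lfunE opp_lfunE id_lfunE => /eqP; rewrite -subr_eq0 addrAC subrr sub0r oppr_eq0 => /eqP.
by rewrite add_lfunE opp_lfunE id_lfunE ev0 subr0.
Qed.

Hypothesis I3 : #|I| = 3.
Hypothesis pos : forall W, W != 0%VS -> tits_pos s F W.

(* Ringel's argument: a nonzero non-injective endomorphism theta of minimal rank
   has square zero; a suitable indecomposable summand A of its kernel N is a
   brick by induction, hence rigid, and rigidity glues the separate
   retractions of U onto A along the three filtrations into a single one. *)
Lemma indec_brick U : indec F U -> brick F U.
Proof.
elim/ltn_ind: {U}(\dim U) {-2}U (erefl (\dim U)) => d IHd U dU indU f ef.
have [U0 indU'] := indU.
have [c [v0 [v0U v0n0 fv0]]] := eigenvector_exists U0 (fmor_sub ef).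
apply: contrapT => nscal.
pose P g := [/\ fendo F U g, exists2 v, v \in U & g v != 0 &
                exists2 v, v \in U & (v != 0) && (g v == 0)].
have [|th [eth [v1 v1U thv1] [v2 v2U /andP[v2n0 thv2]]] th_min] :=
    @ex_min_measure _ P (fun g => \dim (g @: U)).
  (* Shifting a non-scalar f by an eigenvalue gives a nonzero map that kills an eigenvector. *)
  exists (f - c *: \1%VF); split; first by apply: fmorB => //; apply: fendoZ1.
    apply: contrapT => nex; apply: nscal; exists c => v vU; apply/eqP; rewrite -subr_eq0.
    apply: contrapT => /negP ne; apply: nex; exists v => //.
    by rewrite add_lfunE opp_lfunE scale_lfunE id_lfunE.
  by exists v0; rewrite // v0n0 add_lfunE opp_lfunE scale_lfunE id_lfunE fv0 subrr eqxx.
have [th_inj|[n th_nil]] := indec_inj_or_nilp indU eth.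
  by move: v2n0; rewrite (th_inj _ v2U (eqP thv2)) eqxx.
have thU := fmor_sub eth.
(* If th^2 were nonzero on U, minimality would make th injective on its image, against
   nilpotency. *)
have th2 v : v \in U -> th (th v) = 0.
  move=> vU; apply: contrapT => /eqP th2v.
  have /th_min : P (th \o th)%VF.
    split; first exact: (fmor_comp eth eth).
      by exists v => //; rewrite comp_lfunE.
    by exists v2; rewrite // v2n0 comp_lfunE (eqP thv2) linear0 eqxx.
  rewrite limg_comp leqNgt => /negP; apply.
  have := limg_ker_dim th (th @: U); have [ker0 _|] := posnP (\dim (th @: U :&: lker th)); last first.
    by move=> k0 <-; rewrite -[X in (X < _)%N]add0n ltn_add2r.
  have thinj w : w \in (th @: U)%VS -> w != 0 -> th w \in (th @: U)%VS /\ th w != 0.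
    move=> /memv_imgP[u uU ->] w0; split; first by rewrite memv_img ?thU.
    apply: contraTneq w0 => thw; rewrite negbK -memv0.
    move/eqP: ker0; rewrite dimv_eq0 => /eqP <-.
    by rewrite memv_cap memv_img // memv_ker thw eqxx.
  have : iter n th (th v1) \in (th @: U)%VS /\ iter n th (th v1) != 0.
    elim: n {th_nil} => [|n [IH1 IH2]] /=; last exact: thinj.
    by rewrite memv_img.
  by case=> _; rewrite th_nil ?thU // eqxx.
pose N := (U :&: lker th)%VS.
have NU : (N <= U)%VS by apply: capvSl.
have th1N : th v1 \in N by rewrite memv_cap thU // memv_ker th2 // eqxx.
have [e [ide indA ev1]] := indec_summand th1N thv1.
have [ee _] := ide; pose A := (e @: N)%VS.
have AN : (A <= N)%VS := fidem_img ide.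
have thN u : u \in U -> th u \in N by move=> uU; rewrite memv_cap thU // memv_ker th2 // eqxx.
pose th' := (e \o th)%VF.
have mth' : fmor F U F A th'.
  move=> k i v vF vU; have [thF _] := eth k i v vF vU; rewrite comp_lfunE.
  by have [? _] := ee k i (th v) thF (thN v vU); rewrite memv_img ?thN.
have AU := subv_trans AN NU.
have th'min : (\dim (th @: U) <= \dim (th' @: U))%N.
  apply: th_min; split.
  - by move=> k i v vF vU; have [? /(subvP AU)] := mth' k i v vF vU.
  - by exists v1; rewrite // comp_lfunE.
  - by exists v2; rewrite // v2n0 comp_lfunE (eqP thv2) linear0 eqxx.
(* By minimality [th'] has the same rank as [th], so e is injective on the image of [th] and both
   maps have the same kernel on U. *)
have ker_th' v : v \in U -> th' v = 0 -> v \in N.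
  move=> vU th'v; rewrite memv_cap vU memv_ker.
  have := limg_ker_dim e (th @: U); rewrite -limg_comp -/th' => eqd.
  have /eqP : \dim (th @: U :&: lker e) = 0%N.
    by apply/eqP; rewrite -leqn0 -(leq_add2r (\dim (th' @: U))) eqd add0n.
  rewrite dimv_eq0 => /eqP ker0; rewrite -memv0 -ker0 memv_cap memv_img //.
  by rewrite memv_ker -comp_lfunE th'v eqxx.
have ltA : (\dim A < d)%N.
  rewrite -dU; apply: leq_ltn_trans (dimvS AN) _.
  rewrite ltn_neqAle dimvS // andbT; apply/negP=> /eqP eqd.
  have NeqU : N = U by apply/eqP; rewrite eqEdim NU eqd leqnn.
  by move: v1U thv1; rewrite -NeqU memv_cap memv_ker => /andP[_ ->].
have rigA : rigid F A.
  have [A0 _] := indA.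
  by apply: brick_rigid (pos A0) (IHd _ ltA A (erefl _) indA).
have exr k : exists r : 'End(V), fmor1 (F k) U (F k) N r /\ {in N, forall v, r v = v}.
  by have [r ? ?] := filtration_split (filtF k) NU; exists r.
have [r rP] := choice exr.
pose rho k := (e \o r k)%VF.
have rhoE k i v : v \in F k i -> v \in U -> rho k v \in F k i /\ rho k v \in A.
  move=> vF vU; have [rF rN] := (rP k).1 i v vF vU; rewrite comp_lfunE.
  by have [? _] := ee k i _ rF rN; rewrite memv_img.
have rhoA k v : v \in U -> rho k v \in A.
  by move=> vU; have [] := rhoE k s v _ vU; rewrite ?(filt_full (filtF k)) ?memvf.
have rhoN k v : v \in N -> rho k v = e v by move=> vN; rewrite comp_lfunE (rP k).2.
(* All the [rho k] restrict to e on N, so their differences vanish on the kernel of [th'] and factor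
   through [th']. *)
have exh k : exists hk : 'End(V), {in U, forall v, (rho k - rho I0) v = hk (th' v)}.
  apply: lfun_factor => v vU /(ker_th' v vU) vN.
  by rewrite add_lfunE opp_lfunE !rhoN // subrr.
have [h0 h0P] := choice exh.
pose h k := (projv A \o h0 k)%VF.
have [k v vA|hh hhP] := rigA h; first by rewrite comp_lfunE memv_proj.
(* On U, [rho k] is [rho I0] plus [h k] after [th']. So for each k, R is [rho k] plus [hh - h k]
   after [th'], where [hh - h k] is filtered for [F k]. *)
pose R := (rho I0 + (hh \o th'))%VF.
have RE k i v : v \in F k i -> v \in U -> R v \in F k i /\ R v \in A.
  move=> vF vU; have [th'F th'A] := mth' k i v vF vU.
  have [hF hA] := hhP k i _ th'F th'A; have [rF rA] := rhoE k i v vF vU.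
  suff -> : R v = rho k v + (hh - h k) (th' v) by split; apply: memvD.
  have hk : h k (th' v) = rho k v - rho I0 v.
    rewrite comp_lfunE -h0P // add_lfunE opp_lfunE projv_id //.
    by rewrite memvB // rhoA.
  rewrite /R !add_lfunE opp_lfunE hk (comp_lfunE hh th') opprB.
  by rewrite addrCA [rho k v + _]addrC subrK addrC.
have Rfix v : v \in A -> R v = v.
  move=> vA; rewrite add_lfunE (comp_lfunE hh th') rhoN ?(subvP AN) //.
  have -> : th' v = 0.
    by have := subvP AN _ vA; rewrite memv_cap memv_ker comp_lfunE => /andP[_ /eqP->]; rewrite linear0.
  by rewrite linear0 addr0 (fidem_fix ide).
have RA v : v \in U -> R v \in A.
  by move=> vU; have [] := RE I0 s v _ vU; rewrite ?(filt_full (filtF I0)) ?memvf.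
have idR : fidem F U R.
  split=> [k i v vF vU|v vU]; last by rewrite Rfix // RA.
  by have [? /(subvP AU)] := RE k i v vF vU.
have [R0|R1] := indU' R idR.
  move: ev1; have eA := memv_img e th1N.
  by rewrite -(Rfix _ eA) R0 ?eqxx // (subvP AU).
have UA : (U <= A)%VS by apply/subvP=> v vU; rewrite -(R1 v vU) RA.
by have := dimvS UA; rewrite dU leqNgt ltA.
Qed.

End Ringel.

(** * Finite types *)

Section Numerics.
Local Open Scope nat_scope.

Definition sqsum (y : seq nat) : nat := \sum_(i <- y) i ^ 2.

Lemma sumn_sq_le (y : seq nat) : sumn y ^ 2 <= size y * sqsum y.
Proof.
rewrite /sqsum; elim: y => [|u y]; first by rewrite big_nil.
rewrite big_cons /=; move: (size y) (sumn y) (\sum_(i <- y) _) => k m q IH.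
have [k0|] := posnP k.
  have m0 : m = 0 by move: IH; rewrite k0 mul0n leqn0 expn_eq0 andbT => /eqP.
  by rewrite m0 k0; lia.
(* Multiplied by k, this is 2 (k u) m <= (k u)^2 + m^2 combined with the induction hypothesis m^2 <=
   k q. *)
move=> k0; have : 2 * u * m <= k * u ^ 2 + q.
  rewrite -(leq_pmul2l k0).
  have [+ _] := nat_Cauchy (k * u) m; rewrite !expnMn -!mulnn in IH *; nia.
rewrite -!mulnn in IH *; nia.
Qed.

Lemma sumn_le_sqsum (y : seq nat) : sumn y <= sqsum y.
Proof.
rewrite /sqsum; elim: y => [|u y IH]; rewrite ?big_cons //=; nia.
Qed.

(** For the class E^(a). At x = 2 the bounds reduce the claim to 5 y < y^2 + 10, which follows from
    (y - 2)(y - 3) >= 0. *)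
Lemma sqr_sum_lt_min2 x y B C : x <= 2 -> (x + y) ^ 2 <= 3 * B -> x + y <= C -> 0 < x + y ->
  (x + y) ^ 2 < x ^ 2 + y ^ 2 + B + C.
Proof.
have : 5 * y <= y * y + 6 by case: y => [|[|[|y]]] //; rewrite !mulSn !mulnS; lia.
rewrite -!mulnn; case: x => [|[|[|]]] //; rewrite ?mulnDl ?mulnDr; lia.
Qed.

(** For the class S: 2 x y < 2 (x + y) <= B + C. *)
Lemma sqr_sum_lt_min1 x y B C : x <= 1 -> x + y <= B -> x + y <= C -> 0 < x + y ->
  (x + y) ^ 2 < x ^ 2 + y ^ 2 + B + C.
Proof. by rewrite -!mulnn; case: x => [|[|]] //; rewrite ?mulnDl ?mulnDr; lia. Qed.

(** For the class E^(b): A covers half of the square, and 2 v w <= v^2 + w^2 with the linear bound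
    on C covers the rest. *)
Lemma sqr_sum_lt_min1_3 u v w A C : u <= 1 -> (u + v + w) ^ 2 <= 2 * A -> u + v + w <= C ->
  0 < u + v + w -> (u + v + w) ^ 2 < A + (u ^ 2 + v ^ 2 + w ^ 2) + C.
Proof.
have : 2 * (v * w) <= v * v + w * w by have [+ _] := nat_Cauchy v w; rewrite -!mulnn.
by rewrite -!mulnn; case: u => [|[|]] //; rewrite ?mulnDl ?mulnDr; lia.
Qed.

(** Cauchy-Schwarz bounds the three sums below by m^2 / p, m^2 / q and m^2 / r. This suffices when
    1/p + 1/q + 1/r > 1: classes A, D, E_6, E_7, E_8. In the other three a smallest part bounds one
    jump, and a sum of squares is at least the sum. *)
Lemma tits_form_pos (a b c : seq nat) (ya yb yc : seq nat) (m : nat) :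
    let p := size (nonzero_parts a) in
    let q := size (nonzero_parts b) in
    let r := size (nonzero_parts c) in
    (p = 1 /\ 1 <= q <= r) \/ (p = 2 /\ q = 2 /\ 2 <= r) \/
    (p = 2 /\ q = 3 /\ r = 3) \/ (p = 2 /\ q = 3 /\ r = 4) \/ (p = 2 /\ q = 3 /\ r = 5) \/
    (p = 2 /\ q = 3 /\ 3 <= r /\ min_part a = 2) \/
    (p = 2 /\ q = 3 /\ 3 <= r /\ min_part b = 1) \/
    (p = 2 /\ 2 <= q <= r /\ min_part a = 1) ->
    all2 leq ya (nonzero_parts a) -> all2 leq yb (nonzero_parts b) ->
    all2 leq yc (nonzero_parts c) ->
    sumn ya = m -> sumn yb = m -> sumn yc = m -> 0 < m ->
  m ^ 2 < sqsum ya + sqsum yb + sqsum yc.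
Proof.
move=> p q r cls lea leb lec sa sb sc m0.
have sza : size ya = p by move: lea; rewrite all2E => /andP[/eqP].
have szb : size yb = q by move: leb; rewrite all2E => /andP[/eqP].
have szc : size yc = r by move: lec; rewrite all2E => /andP[/eqP].
have := sumn_sq_le ya; have := sumn_sq_le yb; have := sumn_sq_le yc.
have := sumn_le_sqsum yb; have := sumn_le_sqsum yc.
rewrite sa sb sc sza szb szc => lc lb Cc Cb Ca.
have split2 : p = 2 -> exists u v, [/\ sumn ya = u + v, sqsum ya = u ^ 2 + v ^ 2 &
    u <= min_part a \/ v <= min_part a].
  rewrite /p /min_part; move: lea; rewrite /p.
  case: (nonzero_parts a) => [|a1 [|a2 [|]]] //= lea _.
  case: ya lea {sa sza Ca} => [|u [|v [|]]] //=; rewrite ?andbF //.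
  rewrite andbT => /andP[ua va]; exists u, v; rewrite addn0 /sqsum !big_cons !big_nil.
  by split; rewrite ?addn0 //; lia.
have split3 : q = 3 -> min_part b = 1 -> exists u v w,
    [/\ sumn yb = u + v + w, sqsum yb = u ^ 2 + v ^ 2 + w ^ 2 & u <= 1].
  rewrite /q /min_part; move: leb; rewrite /q.
  case: (nonzero_parts b) => [|b1 [|b2 [|b3 [|]]]] //= leb _.
  case: yb leb {sb szb Cb lb} => [|u [|v [|w [|]]]] //=; rewrite ?andbF //.
  rewrite andbT !big_cons big_nil => /and3P[ub vb wb] mb.
  have : u <= 1 \/ v <= 1 \/ w <= 1 by lia.
  rewrite /sqsum !big_cons !big_nil; case=> [|[|]] h.
  - by exists u, v, w; split; lia.
  - by exists v, u, w; split; lia.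
  - by exists w, v, u; split; lia.
have Q1 : m ^ 2 <= sqsum ya + sqsum yb -> m ^ 2 < sqsum ya + sqsum yb + sqsum yc by lia.
move: {lea leb lec} (sqsum ya) (sqsum yb) (sqsum yc) split2 split3 lc lb Cc Cb Ca Q1
  => A B C split2 split3 lc lb Cc Cb Ca Q1.
rewrite sa in split2; rewrite sb in split3.
case: cls => [[p1 _]|[[p2 [q2 _]]|[[p2 [q3 r3]]|[[p2 [q3 r4]]|[[p2 [q3 r5]]|cls]]]]].
- by rewrite p1 in Ca; nia.
- by rewrite p2 in Ca; rewrite q2 in Cb; nia.
- by rewrite p2 in Ca; rewrite q3 in Cb; rewrite r3 in Cc; nia.
- by rewrite p2 in Ca; rewrite q3 in Cb; rewrite r4 in Cc; nia.
- by rewrite p2 in Ca; rewrite q3 in Cb; rewrite r5 in Cc; nia.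
case: cls => [[p2 [q3 [_ mina]]]|[[p2 [q3 [_ minb]]]|[p2 [_ mina]]]].
- have [u [v [mE -> uv]]] := split2 p2; rewrite mina in uv; rewrite q3 mE in Cb.
  rewrite mE in lc m0 *; case: uv => h; first exact: sqr_sum_lt_min2.
  by rewrite (addnC u) in Cb lc m0 *; rewrite (addnC (u ^ 2)) sqr_sum_lt_min2.
- have [u [v [w [mE -> u1]]]] := split3 q3 minb; rewrite p2 mE in Ca.
  by rewrite mE in lc m0 *; apply: sqr_sum_lt_min1_3.
- have [u [v [mE -> uv]]] := split2 p2; rewrite mina in uv.
  rewrite mE in lb lc m0 *; case: uv => h; first exact: sqr_sum_lt_min1.
  by rewrite (addnC u) in lb lc m0 *; rewrite (addnC (u ^ 2)) sqr_sum_lt_min1.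
Qed.

End Numerics.

(** * Decomposition into indecomposables *)

Section Decomposition.
Variables (K : closedFieldType) (V : vectType K) (I : finType) (s : nat).
Implicit Types (U W : {vspace V}) (f e : 'End(V)) (F : I -> nat -> {vspace V}).
Hypothesis I3 : #|I| = 3.
Variable I0 : I.

Local Notation dimT := {ffun I * 'I_s.+1 -> 'I_(\dim {:V}).+1}.

(** The finite value type leaves finitely many lists of bounded length. [inord] truncates nothing,
    as all values are at most the dimension of V. *)
Definition dim_vec F U : dimT := [ffun x : I * 'I_s.+1 => inord (dims F U x.1 x.2)].

Lemma dim_vecE F F' U U' k t : dim_vec F U = dim_vec F' U' -> (t <= s)%N ->
  dims F U k t = dims F' U' k t.
Proof.
move=> eqD ts; have /ffunP/(_ (k, inord t)) := eqD.
rewrite !ffunE /= inordK // => /(congr1 (@nat_of_ord _)).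
by rewrite !inordK // ltnS dimvS ?subvf.
Qed.

Fixpoint decomposes F U (l : seq dimT) : Prop :=
  if l is d :: l' then exists e, [/\ fidem F U e, indec F (e @: U),
    dim_vec F (e @: U) = d & decomposes F ((\1 - e)%VF @: U) l']
  else U = 0%VS.

Section One.
Variable F : I -> nat -> {vspace V}.
Hypothesis filtF : forall k, filtration s (F k).

Lemma decomposition_exists U : exists l, decomposes F U l /\ (size l <= \dim U)%N.
Proof.
elim/ltn_ind: {U}(\dim U) {-2}U (leqnn (\dim U)) => d IHd U dU.
have [->|U0] := eqVneq U 0%VS; first by exists [::].
have pU : vpick U != 0 by rewrite vpick0.
have [e [ide inde ep]] := indec_summand filtF I0 (memv_pick U) pU.
pose U2 := ((\1 - e)%VF @: U)%VS; have ide2 := fidem_compl ide.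
have ltU2 : (\dim U2 < \dim U)%N.
  rewrite ltn_neqAle dimvS ?(fidem_img filtF I0) // andbT; apply/negP=> /eqP eqd.
  have U2U : U2 = U by apply/eqP; rewrite eqEdim (fidem_img filtF I0 ide2) eqd leqnn.
  have epU : e (vpick U) \in U.
    by apply: (subvP (fidem_img filtF I0 ide)); rewrite memv_img ?memv_pick.
  have := fidem_fix ide2 (_ : e (vpick U) \in U2); rewrite U2U => /(_ epU).
  rewrite add_lfunE opp_lfunE id_lfunE (fidem_fix ide (memv_img e (memv_pick U))) subrr.
  by move=> e0; rewrite -e0 eqxx in ep.
have [l [lU2 sl]] := IHd _ (leq_trans ltU2 dU) U2 (leqnn _).
exists (dim_vec F (e @: U) :: l); split; last exact: leq_ltn_trans sl ltU2.
by exists e.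
Qed.

End One.

Section Two.
Variables F F' : I -> nat -> {vspace V}.
Hypothesis filtF : forall k, filtration s (F k).
Hypothesis filtF' : forall k, filtration s (F' k).
Hypothesis posF : forall W, W != 0%VS -> tits_pos s F W.
Hypothesis posF' : forall W, W != 0%VS -> tits_pos s F' W.

(** Summands at the same place of the list are bricks of equal dimensions, hence isomorphic; the
    isomorphisms are summed along the two decompositions. *)
Lemma decomposes_iso l U U' : decomposes F U l -> decomposes F' U' l ->
  exists2 f, fmor F U F' U' f & {in U, forall v, f v = 0 -> v = 0}.
Proof.
elim: l U U' => [|d l IHl] U U' /=.
  move=> -> ->; exists 0 => [k i v _|v]; last by rewrite memv0 => /eqP.
  by rewrite zero_lfunE !mem0v.
move=> [e [ide inde De decl]] [e' [ide' inde' De' decl']].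
have [f2 mf2 inj2] := IHl _ _ decl decl'.
have [f1 mf1 inj1] : exists2 f, fmor F (e @: U) F' (e' @: U') f &
    {in (e @: U)%VS, forall v, f v = 0 -> v = 0}.
  have eqD k t : (t <= s)%N -> dims F (e @: U) k t = dims F' (e' @: U') k t.
    by apply: dim_vecE; rewrite De De'.
  apply: (bricks_iso I3 filtF filtF') => //.
  - by apply: posF; case: inde.
  - by apply: posF'; case: inde'.
  - exact: (indec_brick filtF I0).
  - exact: (indec_brick filtF' I0).
  by rewrite -(dims_full filtF _ I0) -(dims_full filtF' _ I0) eqD.
pose e2 := (\1 - e)%VF; pose e2' := (\1 - e')%VF.
have ide2 : fidem F U e2 := fidem_compl ide.
have ide2' : fidem F' U' e2' := fidem_compl ide'.
have sub1 := subvP (fidem_img filtF' I0 ide'); have sub2 := subvP (fidem_img filtF' I0 ide2').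
exists ((f1 \o e) + (f2 \o e2))%VF => [k i v vF vU|v vU].
  have [eF eU] := ide.1 k i v vF vU; have [e2F e2U] := ide2.1 k i v vF vU.
  have [f1F f1U] := mf1 k i _ eF (memv_img e vU).
  have [f2F f2U] := mf2 k i _ e2F (memv_img e2 vU).
  by rewrite add_lfunE !comp_lfunE; split; apply: memvD => //; [apply: sub1|apply: sub2].
rewrite add_lfunE !comp_lfunE => sum0.
have f1U := fmor_sub filtF I0 mf1 (memv_img e vU).
have f2U := fmor_sub filtF I0 mf2 (memv_img e2 vU).
(* The idempotent e' fixes the values of f1 and kills those of f2, so it separates the two terms of
   the vanishing sum. *)
have e'f2 : e' (f2 (e2 v)) = 0.
  have := fidem_fix ide2' f2U; rewrite add_lfunE opp_lfunE id_lfunE.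
  by move/eqP; rewrite -subr_eq0 addrAC subrr sub0r oppr_eq0 => /eqP.
have f1v : f1 (e v) = 0.
  rewrite -(fidem_fix ide' f1U) -[LHS]addr0 -[X in _ + X]e'f2 -linearD sum0.
  by rewrite linear0.
have f2v : f2 (e2 v) = 0 by rewrite -[LHS]add0r -[X in X + _]f1v.
have ev := inj1 _ (memv_img e vU) f1v.
have := inj2 _ (memv_img e2 vU) f2v.
by rewrite add_lfunE opp_lfunE id_lfunE ev subr0.
Qed.

End Two.
End Decomposition.

(** * Flags as filtrations *)

Section FlagFiltration.
Variables (K : fieldType) (V : vectType K).
Implicit Types (A : seq {vspace V}) (U W : {vspace V}).

(** The default [fullv] extends a flag past its end, so it is a filtration of any length s >= size
    a. *)
Definition flag_filt A i : {vspace V} := nth fullv A i.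

Lemma flag_filtE a A i : Fl a A -> (i <= size a)%N -> flag_filt A i = nth 0%VS A i.
Proof. by case=> sA _ _ _ ia; apply: set_nth_default; rewrite sA. Qed.

Lemma flag_filt_ge a A i : Fl a A -> (size a <= i)%N -> flag_filt A i = fullv.
Proof.
move=> FlA; rewrite leq_eqVlt => /predU1P[<-|ai].
  by rewrite (flag_filtE FlA) //; case: FlA.
by rewrite /flag_filt nth_default //; case: FlA => ->.
Qed.

Lemma flag_filt_filtration a A s : Fl a A -> (size a <= s)%N -> filtration s (flag_filt A).
Proof.
move=> FlA as_; split; last exact: flag_filt_ge as_.
  by rewrite (flag_filtE FlA) //; case: FlA.
have step i : (flag_filt A i <= flag_filt A i.+1)%VS.
  have [ia|ai] := ltnP i (size a); last by rewrite (flag_filt_ge FlA (leqW ai)) subvf.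
  rewrite !(flag_filtE FlA) ?(ltnW ia) //.
  by case: FlA => _ _ _ /(_ i ia) [].
by move=> i j /subnKC <-; elim: (j - i)%N => [|k IH];
  rewrite ?addn0 ?subvv // addnS (subv_trans IH).
Qed.

Lemma flag_filt_dim a A i : Fl a A ->
  \dim (flag_filt A i.+1) = (\dim (flag_filt A i) + nth 0 a i)%N.
Proof.
move=> FlA; have [ia|ai] := ltnP i (size a); last first.
  by rewrite !(flag_filt_ge FlA) ?(leqW ai) // nth_default // addn0.
rewrite !(flag_filtE FlA) ?(ltnW ia) //.
by case: FlA => _ _ _ /(_ i ia) [].
Qed.

Lemma flag_restrict_type a A s W : Fl a A -> (size a <= s)%N -> exists y : seq nat,
  [/\ all2 leq y (nonzero_parts a), sumn y = \dim W &
   sqsum y = \sum_(t < s) (\dim (flag_filt A t.+1 :&: W) - \dim (flag_filt A t :&: W)) ^ 2]%N.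
Proof.
move=> FlA as_; have filtA := flag_filt_filtration FlA as_.
set D := fun t => \dim (flag_filt A t :&: W).
pose x t := (D t.+1 - D t)%N.
have Dm i : (D i <= D i.+1)%N by rewrite dimvS // capvS // (filt_mono filtA).
have xa t : (x t <= nth 0 a t)%N.
  have := dimv_sum_cap (flag_filt A t.+1 :&: W) (flag_filt A t).
  have -> : (flag_filt A t.+1 :&: W :&: flag_filt A t = flag_filt A t :&: W)%VS.
    by rewrite capvC capvA (capv_idPl (filt_mono filtA _)).
  have : (\dim (flag_filt A t.+1 :&: W + flag_filt A t) <= \dim (flag_filt A t.+1))%N.
    by rewrite dimvS // subv_add capvSl (filt_mono filtA).
  rewrite (flag_filt_dim _ FlA) /x -/(D t) -/(D t.+1).
  move: (\dim (_ + _)) (D t) (D t.+1) (\dim (flag_filt A t)) (nth 0 a t); lia.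
pose y := [seq x t | t <- iota 0 (size a) & nth 0 a t != 0].
have sum_y (f : nat -> nat) : f 0 = 0 ->
    (\sum_(i <- y) f i = \sum_(t < s) f (x t))%N.
  move=> f0; rewrite big_map big_filter big_mkcond /=.
  rewrite (eq_bigr (fun t => f (x t))) => [|t _]; last first.
    by have := xa t; case: eqP => //= ->; rewrite leqn0 => /eqP->.
  rewrite -(subn0 (size a)) -/(index_iota 0 (size a)).
  rewrite -(big_mkord xpredT (fun t => f (x t))) [RHS](big_cat_nat (n := size a)) //=.
  rewrite [X in (_ + X)%N]big_nat [X in (_ + X)%N]big1 ?addn0 // => t /andP[ta _].
  by have := xa t; rewrite nth_default // leqn0 => /eqP->.
exists y; split.
- have -> : nonzero_parts a = [seq nth 0 a t | t <- iota 0 (size a) & nth 0 a t != 0].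
    by rewrite /nonzero_parts -{1}(mkseq_nth 0 a) /mkseq filter_map.
  rewrite all2E !size_map eqxx /= /y; elim: [seq _ <- _ | _] => //= t l ->.
  by rewrite xa.
- rewrite sumnE (sum_y id) // /x.
  have : (\sum_(t < s) (D t.+1 - D t) + D 0 = D s)%N.
    elim: (s) => [|k IH]; first by rewrite big_ord0.
    by rewrite big_ord_recr /= addnAC IH subnKC.
  have -> : D 0%N = 0%N by rewrite /D (filt0 filtA) cap0v dimv0.
  by rewrite addn0 => ->; rewrite /D (filt_full filtA) capfv.
by rewrite /sqsum (sum_y (fun i => i ^ 2)%N).
Qed.

End FlagFiltration.

(** * Orbits of triples of flags *)

Section Orbits.
Variables (K : closedFieldType) (V : vectType K).
Implicit Types (X Y : seq {vspace V} * seq {vspace V} * seq {vspace V}) (f g : 'End(V)).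

Lemma GL_lker0 g : GL g <-> lker g == 0%VS.
Proof.
split=> [[h gK _]|g0]; first by apply/lker0P; apply: can_inj gK.
by exists g^-1%VF; [apply: lker0_lfunK | apply: lker0_lfunVK].
Qed.

Lemma flag_act_comp f g A : flag_act f (flag_act g A) = flag_act (f \o g)%VF A.
Proof. by rewrite /flag_act -map_comp; apply: eq_map => U /=; rewrite limg_comp. Qed.

Lemma flag_act1 (A : seq {vspace V}) : flag_act \1%VF A = A.
Proof. by rewrite /flag_act -[RHS]map_id; apply: eq_map => U; rewrite lim1g. Qed.

Lemma flag3_act_comp f g X : flag3_act f (flag3_act g X) = flag3_act (f \o g)%VF X.
Proof. by rewrite /flag3_act /= !flag_act_comp. Qed.

Lemma flag3_act1 X : flag3_act \1%VF X = X.
Proof. by case: X => [[A B] C]; rewrite /flag3_act /= !flag_act1. Qed.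

Lemma GL_comp f g : GL f -> GL g -> GL (f \o g)%VF.
Proof.
move=> /GL_lker0/lker0P fi /GL_lker0/lker0P gi; apply/GL_lker0/lker0P => u v.
by rewrite !comp_lfunE => /fi/gi.
Qed.

Lemma GL_inv f : GL f -> GL (f^-1)%VF.
Proof.
move=> /GL_lker0 f0; apply/GL_lker0/lker0P => u v uv.
by rewrite -(lker0_lfunVK f0 u) uv (lker0_lfunVK f0 v).
Qed.

Lemma GL_orbit_act f X : GL f -> GL_orbit (flag3_act f X) = GL_orbit X.
Proof.
move=> Gf; apply/seteqP; split=> _ [g Gg <-].
  by exists (g \o f)%VF; [apply: GL_comp | rewrite flag3_act_comp].
exists (g \o f^-1)%VF; first by apply: GL_comp => //; apply: GL_inv.
rewrite flag3_act_comp -comp_lfunA lker0_compVf ?comp_lfun1r //.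
exact/GL_lker0.
Qed.

Definition nth3 (T : Type) (x : T * T * T) (k : 'I_3) : T :=
  nth x.1.1 [:: x.1.1; x.1.2; x.2] k.

Definition triple_filt X (k : 'I_3) := flag_filt (nth3 X k).

(** Both flags have type a, so steps of equal index have equal dimension and an injective filtered
    map is onto each of them. *)
Lemma Fl_iso a A B f s : Fl a A -> Fl a B -> (size a <= s)%N -> lker f == 0%VS ->
  fmor1 (flag_filt A) fullv (flag_filt B) fullv f -> flag_act f A = B.
Proof.
move=> FlA FlB as_ f0 mf; have [sA _ _ _] := FlA; have [sB _ _ _] := FlB.
have filtA := flag_filt_filtration FlA as_; have filtB := flag_filt_filtration FlB as_.
have dAB i : \dim (flag_filt A i) = \dim (flag_filt B i).
  elim: i => [|i IH]; first by rewrite (filt0 filtA) (filt0 filtB).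
  by rewrite (flag_filt_dim _ FlA) (flag_filt_dim _ FlB) IH.
apply: (@eq_from_nth _ 0%VS); rewrite ?size_map ?sA ?sB // => i ia.
rewrite (nth_map 0%VS) ?sA // -(flag_filtE FlA ia) -(flag_filtE FlB ia).
apply/eqP; rewrite eqEdim limg_dim_eq ?(eqP f0) ?capv0 // dAB leqnn andbT.
by apply/subvP=> _ /memv_imgP[v vA ->]; have [] := mf i v vA (memvf v).
Qed.

Lemma nth3P (T : Type) (P : T -> Prop) (x : T * T * T) :
  P x.1.1 -> P x.1.2 -> P x.2 -> forall k, P (nth3 x k).
Proof. by move=> P1 P2 P3 [[|[|[|]]]]. Qed.

Lemma Fl_nth3 a b c X : (Fl a `*` Fl b `*` Fl c)%classic X ->
  forall k, Fl (nth3 (a, b, c) k) (nth3 X k).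
Proof. by move=> [[? ?] ?] [[|[|[|]]]]. Qed.

Lemma triple_iso a b c s X Y f : (Fl a `*` Fl b `*` Fl c)%classic X ->
    (Fl a `*` Fl b `*` Fl c)%classic Y -> (forall k, size (nth3 (a, b, c) k) <= s)%N ->
    lker f == 0%VS -> fmor (triple_filt X) fullv (triple_filt Y) fullv f ->
  flag3_act f X = Y.
Proof.
move=> FlX FlY sz f0 mf.
have E k : flag_act f (nth3 X k) = nth3 Y k.
  exact: (Fl_iso (Fl_nth3 FlX k) (Fl_nth3 FlY k) (sz k) f0 (mf k)).
case: X Y E {FlX FlY mf} => [[X1 X2] X3] [[Y1 Y2] Y3] E; rewrite /flag3_act /=.
have E1 := E ord0; have E2 := E (@Ordinal 3 1 isT); have E3 := E (@Ordinal 3 2 isT).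
by rewrite /nth3 /= in E1 E2 E3; rewrite E1 E2 E3.
Qed.

End Orbits.

Lemma sum_nth3 (f : 'I_3 -> nat) :
  (\sum_k f k = f ord0 + f (@Ordinal 3 1 isT) + f (@Ordinal 3 2 isT))%N.
Proof.
rewrite !big_ord_recr big_ord0 /= add0n.
by congr (f _ + f _ + f _)%N; apply: val_inj.
Qed.

Lemma tits_pos_finite_type (K : closedFieldType) (V : vectType K) (a b c : seq nat) :
    (forall ya yb yc m, all2 leq ya (nonzero_parts a) -> all2 leq yb (nonzero_parts b) ->
       all2 leq yc (nonzero_parts c) -> sumn ya = m -> sumn yb = m -> sumn yc = m ->
       0 < m -> m ^ 2 < sqsum ya + sqsum yb + sqsum yc)%N ->
  finite_type V a b c.
Proof.
move=> pos; pose Fl3 := (@Fl K V a `*` @Fl K V b `*` @Fl K V c)%classic.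
pose s := maxn (size a) (maxn (size b) (size c)).
have sz k : (size (nth3 (a, b, c) k) <= s)%N.
  by apply: (nth3P (P := fun l : seq nat => (size l <= s)%N)); rewrite /s /=; lia.
have filtX X : Fl3 X -> forall k, filtration s (triple_filt X k).
  by move=> FlX k; apply: flag_filt_filtration (Fl_nth3 FlX k) (sz k).
have posX X : Fl3 X -> forall W, W != 0%VS -> tits_pos s (triple_filt X) W.
  move=> FlX W W0; rewrite /tits_pos sum_nth3 /dims /triple_filt.
  have E k := flag_restrict_type W (Fl_nth3 FlX k) (sz k).
  have [ya [la sa <-]] := E ord0.
  have [yb [lb sb <-]] := E (@Ordinal 3 1 isT).
  have [yc [lc sc <-]] := E (@Ordinal 3 2 isT).
  by apply: pos la lb lc sa sb sc _; rewrite lt0n dimv_eq0.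
pose dimT := {ffun 'I_3 * 'I_s.+1 -> 'I_(\dim {:V}).+1}.
(* Each list selects one triple realizing it, with [set0] for lists that do not occur. Triples with
   the same list are isomorphic, so every orbit is a value of [orb]. *)
pose orb (l : (\dim {:V}).-bseq dimT) := 
  if pselect (exists X, Fl3 X /\ decomposes (triple_filt X) fullv l) is left ex
  then GL_orbit (projT1 (cid ex)) else set0.
apply: (@sub_finite_set _ _ (range orb)); last exact/finite_image/finite_finset.
move=> _ [X FlX <-].
have [l [decX sl]] := decomposition_exists (ord0 : 'I_3) (filtX X FlX) fullv.
exists (Bseq sl) => //; rewrite /orb; case: pselect => [ex|]; last by case; exists X.
case: cid => Y [FlY decY] /=.
have [f mf finj] := decomposes_iso (card_ord 3) ord0 (filtX Y FlY) (filtX X FlX)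
  (posX Y FlY) (posX X FlX) decY decX.
have f0 : lker f == 0%VS.
  by rewrite -subv0; apply/subvP=> v; rewrite memv_ker memv0 => /eqP/(finj v (memvf v))->.
have <- := triple_iso FlY FlX sz f0 mf.
by rewrite GL_orbit_act //; apply/GL_lker0.
Qed.

(** * Infinite types *)

(** Euclid's argument: a root of p + 1 lies outside the list l. As 0 is in l, p + 1 is not
    constant. *)
Lemma closed_field_infinite (K : closedFieldType) : infinite_set [set: K].
Proof.
move=> /finite_seqP[l lE]; pose p : {poly K} := \prod_(x <- l) ('X - x%:P).
have l0 : 0 \in l by have : [set` l]%classic 0 by rewrite -lE.
have sp : size (p + 1) != 1%N.
  have szp : size p = (size l).+1 by apply: size_prod_XsubC.
  by rewrite size_polyDl ?szp ?size_poly1 ?ltnS ?eqSS; case: (l) l0.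
have [z] := closed_rootP (p + 1) sp; rewrite rootE hornerD hornerC.
have -> : p.[z] = 0.
  by apply/rootP; rewrite root_prod_XsubC; have : [set` l]%classic z by rewrite -lE.
by rewrite add0r oner_eq0.
Qed.

Section Fibers.
Local Open Scope classical_set_scope.

Lemma infinite_fiber (T U : Type) (f : T -> U) :
  infinite_set [set: T] -> finite_set (range f) ->
  exists y, infinite_set [set x | f x = y].
Proof.
move=> infT finf; apply: contrapT => nex; apply: infT.
have -> : [set: T] = \bigcup_(y in range f) [set x | f x = y].
  by apply/seteqP; split=> // x _; exists (f x) => //; exists x.
apply: bigcup_finite => // y _; apply: contrapT => ny; apply: nex; by exists y.
Qed.

End Fibers.

Lemma perm_eq_extend (P C : seq nat) :
  (forall t, count_mem t P <= count_mem t C)%N -> exists R, perm_eq (P ++ R) C.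
Proof.
elim: P C => [|t P IHP] C le; first by exists C.
have tC : t \in C by rewrite -has_pred1 has_count; have := le t; rewrite /= eqxx; lia.
have [|R PR] := IHP (rem t C).
  move=> u; have := le u; rewrite count_rem /= tC eq_sym.
  by case: eqP => [->|_] /=; lia.
exists R; rewrite /= perm_sym; apply: perm_trans (perm_to_rem tC) _.
by rewrite perm_cons perm_sym.
Qed.

(** * Coordinate flags of a prescribed type *)

Section CoordinateFlags.
Variables (K : fieldType) (V : vectType K) (n : nat) (b : n.-tuple V).
Hypothesis bV : basis_of fullv b.

Definition coord_space (P : pred 'I_n) := <<[seq b`_(nat_of_ord j) | j <- enum P]>>%VS.

Lemma coord_space_basis P : basis_of (coord_space P) [seq b`_(nat_of_ord j) | j <- enum P].
Proof.
rewrite /basis_of eqxx /=.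
apply: (@catl_free _ _ [seq b`_(nat_of_ord j) | j <- enum (predC P)]).
rewrite -map_cat (@perm_free _ _ _ b) ?(basis_free bV) //.
have bE : tval b = [seq b`_(nat_of_ord j) | j <- enum 'I_n].
  have sz : size (enum 'I_n) = n by rewrite size_enum_ord.
  apply: (@eq_from_nth _ 0) => [|i]; first by rewrite size_map size_tuple -[LHS]sz enumT.
  rewrite size_tuple => lti.
  by rewrite (nth_map (Ordinal lti)) ?sz // nth_enum_ord.
rewrite [X in perm_eq _ X]bE; apply: perm_map.
by rewrite [enum 'I_n]enumT; apply/permPl/perm_filterC.
Qed.

Lemma dim_coord_space P : \dim (coord_space P) = #|P|.
Proof.
have := coord_space_basis P; move/(size_basis (X := in_tuple _)) => ->.
by rewrite size_map -cardE.
Qed.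

Lemma mem_coord_space (P : pred 'I_n) v :
  v \in coord_space P <-> forall j, ~~ P j -> crd b v 0 j = 0.
Proof.
split=> [|v0].
  move=> /(coord_span (X := in_tuple _)) -> j Pj.
  rewrite linear_sum summxE big1 // => i _; rewrite linearZ mxE /= mxE.
  have /mapP[l + ->] := mem_nth 0 (ltn_ord i); rewrite mem_enum => Pl.
  rewrite coord_free ?(basis_free bV) //; case: eqP => [lj|]; last by rewrite mulr0.
  by move: Pj; rewrite (_ : j = l) 1?[P l]Pl //; apply: val_inj.
rewrite -(crdK bV (memvf v)); apply: memv_suml => j _.
case: (boolP (P j)) => [Pj|/v0->]; last by rewrite scale0r mem0v.
by apply/memvZ/memv_span/mapP; exists j; rewrite ?mem_enum.
Qed.

(** The j-th basis vector lies in step t exactly when t > [col j], so [col j] is the 0-based index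
    of the part that counts it. *)
Definition coord_flag s (col : 'I_n -> nat) :=
  [seq coord_space [pred j | col j < t]%N | t <- iota 0 s.+1].

Lemma nth_coord_flag s col t : (t <= s)%N ->
  nth 0%VS (coord_flag s col) t = coord_space [pred j | col j < t]%N.
Proof. by move=> ts; rewrite (nth_map 0%N) ?size_iota // nth_iota. Qed.

Lemma coord_flag_Fl a col : (forall j, col j < size a)%N ->
    (forall t, t < size a -> #|[pred j | col j == t]| = nth 0 a t)%N ->
  Fl a (coord_flag (size a) col).
Proof.
move=> col_lt card_col; split.
- by rewrite size_map size_iota.
- rewrite nth_coord_flag //; apply/eqP; rewrite -dimv_eq0 dim_coord_space.
  by apply/eqP/eq_card0 => j; rewrite inE.
- rewrite nth_coord_flag //; apply/vspaceP=> v; rewrite memvf; apply/mem_coord_space => j.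
  by rewrite /= col_lt.
move=> t ts; rewrite !nth_coord_flag // ?(ltnW ts) //; split.
  apply/subvP=> v /mem_coord_space v0; apply/mem_coord_space => j /=.
  by rewrite -leqNgt => /ltnW tj; apply: v0; rewrite /= -leqNgt.
rewrite !dim_coord_space -card_col //.
rewrite -(cardID [pred j | col j < t]%N [pred j | col j < t.+1]%N); congr (_ + _)%N.
  by apply: eq_card => j; rewrite !inE ltnS; case: ltngtP.
by apply: eq_card => j; rewrite !inE ltnS; case: ltngtP.
Qed.

End CoordinateFlags.

(** The pattern [pat] numbers only non-zero parts; [ia] translates it increasingly into positions in
    a. No color is overused, so the translated pattern extends to an arrangement of the full
    multiset [C] of colors. *)
Lemma coloring_exists (a pat : seq nat) m k : size pat = m -> sumn a = (m + k)%N ->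
    all (fun c => c < size (nonzero_parts a))%N pat ->
    (forall c, c < size (nonzero_parts a) ->
       count_mem c pat <= nth 0 (nonzero_parts a) c)%N ->
  exists col : 'I_(m + k) -> nat,
    [/\ forall j, (col j < size a)%N,
        forall t, (t < size a)%N -> #|[pred j | col j == t]| = nth 0%N a t &
        forall i j : 'I_m, (nth 0 pat i < nth 0 pat j)%N ->
          (col (lshift k i) < col (lshift k j))%N].
Proof.
move=> spat suma /allP pat_lt pat_count.
pose ia := [seq t <- iota 0 (size a) | nth 0%N a t != 0%N].
have naE : nonzero_parts a = [seq nth 0%N a t | t <- ia].
  by rewrite /nonzero_parts -{1}(mkseq_nth 0%N a) /mkseq filter_map.
have sia : size (nonzero_parts a) = size ia by rewrite naE size_map.
have uia : uniq ia by rewrite filter_uniq ?iota_uniq.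
pose C := flatten [seq nseq (nth 0%N a t) t | t <- iota 0 (size a)].
have sC : size C = (m + k)%N.
  rewrite -suma size_flatten /shape -map_comp -[in RHS](mkseq_nth 0%N a); congr sumn.
  by apply: eq_map => t /=; rewrite size_nseq.
have countC t : (count_mem t C = if t < size a then nth 0 a t else 0)%N.
  rewrite count_flatten -map_comp sumnE big_map.
  rewrite (eq_bigr (fun u => if u == t then nth 0%N a t else 0%N)) => [|u _]; last first.
    by rewrite /= count_nseq /=; case: eqP => [->|_]; rewrite ?mul1n ?mul0n.
  rewrite -big_mkcond /= big_const_seq.
  have -> : count (fun u => u == t) (iota 0 (size a)) = (t < size a)%N.
    by rewrite count_uniq_mem ?iota_uniq // mem_iota.
  by case: ltnP => //= _; rewrite addn0.
pose P := [seq nth 0%N ia c | c <- pat].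
have nth_ia c : c \in pat -> nth 0%N ia c \in ia by move=> cp; rewrite mem_nth // -sia pat_lt.
have leP t : (count_mem t P <= count_mem t C)%N.
  have [tP|] := boolP (t \in P); last by move=> /count_memPn->.
  have /mapP[c cp tE] := tP; have tia : t \in ia by rewrite tE nth_ia.
  have cs : (c < size ia)%N by rewrite -sia pat_lt.
  rewrite countC; have := tia; rewrite mem_filter mem_iota /= add0n => /andP[_ ->].
  have := pat_count c; rewrite sia naE (nth_map 0%N) // -tE => /(_ cs).
  rewrite count_map; apply: leq_trans.
  rewrite -!size_filter (eq_in_filter (a2 := pred1 c)) //.
  by move=> d dp /=; rewrite tE nth_uniq // -sia pat_lt.
have [R PRC] := perm_eq_extend leP; pose Q := P ++ R.
have sQ : size Q = (m + k)%N by rewrite (perm_size PRC).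
exists (fun j => nth 0%N Q j); split=> [j|t ts|i j].
- have : nth 0%N Q j \in C by rewrite -(perm_mem PRC) mem_nth // sQ.
  by rewrite -has_pred1 has_count countC /=; case: ifP.
- have -> : nth 0%N a t = count_mem t Q by rewrite (permP PRC) countC ts.
  rewrite -{2}[Q](mkseq_nth 0%N) sQ /mkseq count_map -val_enum_ord count_map.
  by rewrite cardE [enum 'I_(m + k)]enumT size_filter; apply: eq_count.
have sP : size P = m by rewrite size_map.
rewrite /= !nth_cat !sP !ltn_ord !(nth_map 0%N) ?spat //.
have ip : nth 0%N pat i \in pat by rewrite mem_nth ?spat.
have jp : nth 0%N pat j \in pat by rewrite mem_nth ?spat.
move=> ij; have sia_lt : sorted ltn ia by apply: (sorted_filter ltn_trans); apply: iota_ltn_sorted.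
by rewrite (sorted_ltn_nth ltn_trans) // inE -sia pat_lt.
Qed.

(** * Orthogonal families meet infinitely many orbits *)

Section Family.
Variables (K : closedFieldType) (V : vectType K) (m k : nat).
Variable b : (m.+1 + k).-tuple V.
Hypothesis bV : basis_of fullv b.
Variable G : K -> 'M[K]_m.+1.
Hypothesis G_unit : forall x, G x \in unitmx.

Definition block1 (M : 'M[K]_m.+1) : 'M_(m.+1 + k) := block_mx M 0 0 1%:M.

Lemma block1_unit M : M \in unitmx -> block1 M \in unitmx.
Proof. by rewrite !unitmxE det_lblock det1 mulr1. Qed.

Definition family_map x : 'End(V) := mxmap b b (block1 (G x)).

Lemma crd_mxmap M v : crd b (mxmap b b M v) = crd b v *m M.
Proof. by have [] := mxmapP b M v bV. Qed.

Lemma crd_eq u v : crd b u = crd b v -> u = v.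
Proof. by apply: (crd_inj bV); apply: memvf. Qed.

Lemma mxmap_GL M : M \in unitmx -> GL (mxmap b b M).
Proof.
move=> uM; exists (mxmap b b (invmx M)) => v; apply: crd_eq; rewrite !crd_mxmap.
  by rewrite mulmxK.
by rewrite mulmxKV.
Qed.

Lemma mxmap_exists (f : 'End(V)) : exists M, forall v, crd b (f v) = crd b v *m M.
Proof.
have [M fM] := mxmap_onto (f := f) bV bV (fun v _ => memvf _).
by exists M => v; have [] := fM v (memvf v).
Qed.

Lemma crd_basis (i : 'I_(m.+1 + k)) : crd b b`_i = delta_mx 0 i.
Proof. by apply/rowP=> j; rewrite !mxE coord_free ?(basis_free bV) // eq_sym. Qed.

(** The i-th basis vector first appears in step [(col i).+1], which f preserves, so its image has no
    coordinate of larger color. *)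
Lemma flag_act_coord s col (f : 'End(V)) M i j :
    (forall v, crd b (f v) = crd b v *m M) -> (forall j, col j < s)%N ->
    flag_act f (coord_flag b s col) = coord_flag b s col ->
  (col i < col j)%N -> M i j = 0.
Proof.
move=> fM col_s fF ij.
have ts : (col i < s.+1)%N by rewrite ltnS ltnW.
have := congr1 (nth 0%VS ^~ (col i).+1) fF.
rewrite (nth_map 0%VS) ?size_map ?size_iota ?ltnS // nth_coord_flag // => fE.
have /(memv_img f) : b`_i \in coord_space b [pred j | col j < (col i).+1]%N.
  apply/(mem_coord_space bV) => l /=; rewrite -leqNgt crd_basis mxE eqxx /=.
  by case: eqP => // ->; rewrite ltnn.
rewrite fE => /(mem_coord_space bV)/(_ j).
by rewrite fM crd_basis -rowE mxE /= -leqNgt => ->.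
Qed.

Variables (a b' c : seq nat) (pa pb pc : seq nat).
Hypothesis orth : forall (x y : K) (H T : 'M[K]_m.+1), x != y ->
  (forall i j : 'I_m.+1, (nth 0 pb i < nth 0 pb j)%N -> H i j = 0) ->
  (forall i j : 'I_m.+1, (nth 0 pc i < nth 0 pc j)%N -> H i j = 0) ->
  (forall i j : 'I_m.+1, (nth 0 pa i < nth 0 pa j)%N -> T i j = 0) ->
  G x *m H = T *m G y -> H 0 0 = 0.
Variables ca cb cc : 'I_(m.+1 + k) -> nat.

Definition is_coloring (l pat : seq nat) (col : 'I_(m.+1 + k) -> nat) :=
  [/\ forall j, (col j < size l)%N,
      forall t, (t < size l)%N -> #|[pred j | col j == t]| = nth 0%N l t &
      forall i j : 'I_m.+1, (nth 0 pat i < nth 0 pat j)%N ->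
          (col (lshift k i) < col (lshift k j))%N].

Hypotheses (colA : is_coloring a pa ca) (colB : is_coloring b' pb cb)
           (colC : is_coloring c pc cc).

Definition family x := (flag_act (family_map x) (coord_flag b (size a) ca),
                        coord_flag b (size b') cb, coord_flag b (size c) cc).

Lemma flag_act_Fl l A f : GL f -> @Fl K V l A -> Fl l (flag_act f A).
Proof.
move=> /GL_lker0 f0 [sA A0 As Ai].
have dimf U : \dim (f @: U) = \dim U by rewrite limg_dim_eq // (eqP f0) capv0.
have nthA i : (i <= size l)%N -> nth 0%VS (flag_act f A) i = (f @: nth 0%VS A i)%VS.
  by move=> il; rewrite (nth_map 0%VS) // sA.
split=> [|||i il]; rewrite ?size_map ?nthA ?(ltnW il) //.
- by rewrite A0 limg0.
- by rewrite As lker0_limgf.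
by rewrite !dimf; have [? ?] := Ai i il; split; rewrite // limgS.
Qed.

Lemma family_GL x : GL (family_map x).
Proof. exact/mxmap_GL/block1_unit. Qed.

Lemma family_Fl x : (Fl a `*` Fl b' `*` Fl c)%classic (family x).
Proof.
case: colA colB colC => a1 a2 _ [b1 b2 _] [c1 c2 _].
split; [split|]; [apply: flag_act_Fl; first exact: family_GL| |];
by apply: coord_flag_Fl.
Qed.

(** The matrix M of f is triangular for the last two flags, and its conjugate N by the blocks of G x
    and G y for the first. The upper left blocks of the relation [NM] satisfy the equation in
    [orth]. *)
Lemma family_orth x y f : GL f -> flag3_act f (family x) = family y -> x != y ->
  coord b (lshift k 0) (f b`_(lshift k (0 : 'I_m.+1))) = 0.
Proof.
move=> Gf fxy xy; have [M fM] := mxmap_exists f.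
have [a1 _ a3] := colA; have [b1 _ b3] := colB; have [c1 _ c3] := colC.
have [fA fB fC] : [/\ flag_act f (family x).1.1 = (family y).1.1,
    flag_act f (family x).1.2 = (family y).1.2 & flag_act f (family x).2 = (family y).2].
  by rewrite -fxy.
have uy := block1_unit (G_unit y).
pose N := block1 (G x) *m M *m invmx (block1 (G y)).
have NE v : crd b (((family_map y)^-1 \o (f \o family_map x))%VF v) = crd b v *m N.
  have := family_GL y; move=> /GL_lker0 ky.
  rewrite !comp_lfunE; set w := (family_map y)^-1%VF _.
  have : crd b (family_map y w) = crd b w *m block1 (G y) by apply: crd_mxmap.
  by rewrite lker0_lfunVK // fM crd_mxmap /N !mulmxA => ->; rewrite mulmxK.
have N0 i j : (ca i < ca j)%N -> N i j = 0.
  apply: (flag_act_coord NE a1); have ky := family_GL y.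
  rewrite -!flag_act_comp [X in flag_act _ X]fA flag_act_comp lker0_compVf ?flag_act1 //.
  exact/GL_lker0.
have M0 i j : (cb i < cb j)%N \/ (cc i < cc j)%N -> M i j = 0.
  by case; [apply: (flag_act_coord fM b1 fB)|apply: (flag_act_coord fM c1 fC)].
have NM : block1 (G x) *m M = N *m block1 (G y) by rewrite mulmxKV.
clearbody N; have := congr1 ulsubmx NM; rewrite -{1}(submxK M) -{1}(submxK N) !mulmx_block.
rewrite !block_mxKul !mul0mx !mulmx0 !addr0 => GMN.
suff : ulsubmx M 0 0 = 0.
  by rewrite !mxE => <-; have := congr1 (fun r : 'rV_ _ => r 0 (lshift k 0)) (fM b`_(lshift k (0 : 'I_m.+1)));
  rewrite crd_basis -rowE !mxE.
apply: (orth xy _ _ _ GMN) => i j ij; rewrite !mxE.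
- by apply: M0; left; apply: b3.
- by apply: M0; right; apply: c3.
- by apply: N0; apply: a3.
Qed.

(** Otherwise more than dim V parameters share an orbit. Let h x carry the triple at x to a fixed
    one, and let u be the first basis vector. Applying the inverse of h y and reading the first
    coordinate sends h y u to 1 and, by [family_orth], the other h z u to 0. So the h x u are
    independent, and too many. *)
Lemma family_infinite_type : ~ finite_type V a b' c.
Proof.
move=> fin; pose orb x := GL_orbit (family x).
have finorb : finite_set (range orb).
  apply: sub_finite_set fin => _ [x _ <-]; exists (family x) => //; exact: family_Fl.
have [O infO] := infinite_fiber (@closed_field_infinite K) finorb.
have [B subB cardB] := infinite_set_fset (m.+1 + k).+1 infO.
have [x0 x0B] : exists x0, x0 \in B.
  by apply/fset0Pn; rewrite -cardfs_gt0; apply: leq_trans cardB.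
have hP x : exists f, x \in B -> GL f /\ flag3_act f (family x) = family x0.
  have [xB|xB] := boolP (x \in B); last by exists 0.
  have xO : orb x = O := subB x xB; have x0O : orb x0 = O := subB x0 x0B.
  have : orb x (family x0).
    rewrite xO -x0O; exists \1%VF; last by rewrite flag3_act1.
    by apply/GL_lker0/lker0P => u v; rewrite !id_lfunE.
  by case=> f Gf fx; exists f.
have [h hB] := choice hP.
pose u := b`_(lshift k (0 : 'I_m.+1)); pose X := [seq h x u | x <- enum_fset B].
suff freeX : free X.
  have := freeX; rewrite /free => /eqP dX; have := dimvS (subvf <<X>>).
  rewrite dX size_map (size_basis bV) leqNgt; apply/negP; rewrite negbK.
  exact: cardB.
have inB i : (i < size X)%N -> nth 0 (enum_fset B) i \in B.
  by rewrite size_map => iX; apply: mem_nth.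
suff: free (in_tuple X) by [].
apply/freeP => cf sum0 i.
pose y := nth 0 (enum_fset B) i; have yB : y \in B := inB _ (ltn_ord i).
have [Gy hy] := hB y yB; have ky : lker (h y) == 0%VS by apply/GL_lker0.
have := congr1 (fun v => coord b (lshift k 0) ((h y)^-1%VF v)) sum0.
rewrite !linear0 !linear_sum (bigD1 i) //= big1 ?addr0 => [|j ji].
  rewrite !linearZ /= (nth_map 0) -?(size_map (fun x => h x u)) // -/y lker0_lfunK //.
  by rewrite coord_free ?(basis_free bV) // eqxx mulr1.
rewrite !linearZ /= (nth_map 0) -?(size_map (fun x => h x u)) //.
set z := nth _ _ _; have zB : z \in B := inB _ (ltn_ord j).
have [Gz hz] := hB z zB; rewrite -comp_lfunE (@family_orth z y) ?mulr0 //.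
- by apply: GL_comp => //; apply: GL_inv.
- rewrite -flag3_act_comp hz -hy flag3_act_comp lker0_compVf // flag3_act1 //.
rewrite /z /y nth_uniq ?fset_uniq // -?(size_map (fun x => h x u)) //.
Qed.

End Family.

(** * The three critical families *)

Section CriticalFamilies.
Variable K : closedFieldType.

Definition rows_mx m (r : seq (seq K)) : 'M[K]_m := \matrix_(i, j) nth 0 (nth [::] r i) j.

Lemma unitriangular_unit m (M : 'M[K]_m) :
  (forall i j : 'I_m, (j < i)%N -> M i j = 0) -> (forall i, M i i = 1) -> M \in unitmx.
Proof.
move=> M0 M1; rewrite unitmxE -det_tr det_trig.
  by rewrite big1 ?unitr1 // => i _; rewrite mxE.
by apply/is_trig_mxP => i j ij; rewrite mxE M0.
Qed.

(* A matrix vanishing where one of the orderings forces it to, with the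
   vanishing made computable on numeral indices. *)
Lemma mx_mask m (M : 'M[K]_m.+1) (P : nat -> nat -> bool) :
  (forall i j : 'I_m.+1, P i j -> M i j = 0) ->
  exists h : nat -> nat -> K, forall i j : 'I_m.+1, M i j = if P i j then 0 else h i j.
Proof.
move=> M0; exists (fun i j => M (inord i) (inord j)) => i j.
by rewrite !inord_val; case: ifP => // /M0.
Qed.

(* The rows form an adapted basis of the first flag of M_x; the other two flags
   of M_x are coordinate flags, for the orderings listed in the lemmas below. *)
Definition E6_rows x : seq (seq K) := [:: [:: 1; 1; 1]; [:: 0; 1; x]; [:: 0; 0; 1]].
Definition E7_rows x : seq (seq K) :=
  [:: [:: 1; 0; 1; 1]; [:: 0; 1; 1; x]; [:: 0; 0; 1; 0]; [:: 0; 0; 0; 1]].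
Definition E8_rows x : seq (seq K) :=
  [:: [:: 1; 0; 0; 0; 1; 1]; [:: 0; 1; 0; 1; 0; x]; [:: 0; 0; 1; 1; 1; 0];
      [:: 0; 0; 0; 1; 0; 0]; [:: 0; 0; 0; 0; 1; 0]; [:: 0; 0; 0; 0; 0; 1]].

Lemma E6_unit x : rows_mx 3 (E6_rows x) \in unitmx.
Proof.
apply: unitriangular_unit => [[i i3] [j j3]|[i i3]]; rewrite mxE /=.
  by case: i i3 => [|[|[|]]] // _; case: j j3 => [|[|[|]]].
by case: i i3 => [|[|[|]]].
Qed.

Lemma E7_unit x : rows_mx 4 (E7_rows x) \in unitmx.
Proof.
apply: unitriangular_unit => [[i i3] [j j3]|[i i3]]; rewrite mxE /=.
  by case: i i3 => [|[|[|[|]]]] // _; case: j j3 => [|[|[|[|]]]].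
by case: i i3 => [|[|[|[|]]]].
Qed.

Lemma E8_unit x : rows_mx 6 (E8_rows x) \in unitmx.
Proof.
apply: unitriangular_unit => [[i i3] [j j3]|[i i3]]; rewrite mxE /=.
  by case: i i3 => [|[|[|[|[|[|]]]]]] // _; case: j j3 => [|[|[|[|[|[|]]]]]].
by case: i i3 => [|[|[|[|[|[|]]]]]].
Qed.

(** Passing to numeral indices lets sums and forced zeros be evaluated by computation. *)
Lemma orth_equations m (r : K -> seq (seq K)) (pa pb pc : seq nat) (x y : K)
    (H T : 'M[K]_m.+1) :
  let ent u i j := nth 0 (nth [::] (r u) i) j in
  (forall i j : 'I_m.+1, (nth 0 pb i < nth 0 pb j)%N -> H i j = 0) ->
  (forall i j : 'I_m.+1, (nth 0 pc i < nth 0 pc j)%N -> H i j = 0) ->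
  (forall i j : 'I_m.+1, (nth 0 pa i < nth 0 pa j)%N -> T i j = 0) ->
  rows_mx _ (r x) *m H = T *m rows_mx _ (r y) ->
  exists h t : nat -> nat -> K, H 0 0 = h 0%N 0%N /\
    forall i j : nat, (i < m.+1)%N -> (j < m.+1)%N ->
      \sum_(0 <= l < m.+1) ent x i l *
        (if (nth 0 pb l < nth 0 pb j)%N || (nth 0 pc l < nth 0 pc j)%N then 0 else h l j) =
      \sum_(0 <= l < m.+1)
        (if (nth 0 pa i < nth 0 pa l)%N then 0 else t i l) * ent y l j.
Proof.
move=> ent Hb Hc Ta GH.
have [|h hE] := @mx_mask m H
  (fun i j => (nth 0 pb i < nth 0 pb j)%N || (nth 0 pc i < nth 0 pc j)%N).
  by move=> i j /orP[/Hb|/Hc].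
have [t tE] := mx_mask (P := fun i j => (nth 0 pa i < nth 0 pa j)%N) Ta.
exists h, t; split=> [|i j im jm]; first by rewrite hE !ltnn.
have /matrixP/(_ (Ordinal im) (Ordinal jm)) := GH; rewrite !mxE !big_mkord => eqs.
transitivity (\sum_(l < m.+1) rows_mx _ (r x) (Ordinal im) l * H l (Ordinal jm)).
  by apply: eq_bigr => l _; rewrite hE mxE.
by rewrite eqs; apply: eq_bigr => l _; rewrite tE mxE.
Qed.

Lemma eigen_eq (u x y : K) : x != y -> x * u = u * y -> u = 0.
Proof.
move=> xy /eqP; rewrite mulrC -subr_eq0 -mulrBr mulf_eq0 subr_eq0 (negbTE xy) orbF.
by move/eqP.
Qed.

Let simp0 := (mul0r, mulr0, mul1r, mulr1, add0r, addr0).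

(** Opposite orderings make H diagonal; row 0 makes it scalar, H = u, and row 1 gives x u = u y. *)
Lemma E6_orth (x y : K) (H T : 'M[K]_3) : x != y ->
  (forall i j : 'I_3, (nth 0 [:: 0; 1; 2] i < nth 0 [:: 0; 1; 2] j)%N -> H i j = 0) ->
  (forall i j : 'I_3, (nth 0 [:: 2; 1; 0] i < nth 0 [:: 2; 1; 0] j)%N -> H i j = 0) ->
  (forall i j : 'I_3, (nth 0 [:: 0; 1; 2] i < nth 0 [:: 0; 1; 2] j)%N -> T i j = 0) ->
  rows_mx _ (E6_rows x) *m H = T *m rows_mx _ (E6_rows y) -> H 0 0 = 0.
Proof.
move=> xy Hb Hc Ta GH; have [h [t [-> E]]] := orth_equations Hb Hc Ta GH.
have := (E 0%N 0%N isT isT, E 0%N 1%N isT isT, E 0%N 2%N isT isT,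
         E 1%N 0%N isT isT, E 1%N 1%N isT isT, E 1%N 2%N isT isT).
rewrite /index_iota /= !big_cons !big_nil /= !simp0.
case=> [[[[[e00 e01] e02] e10] e11] e12].
by rewrite e00; apply: (eigen_eq xy); rewrite -{1}e02 e12 -e10 add0r -e01 e11 -e10 add0r.
Qed.

(** H is again diagonal. Row 0 equates its entries 0, 2, 3 to some u, and row 1 gives x u = u y. *)
Lemma E7_orth (x y : K) (H T : 'M[K]_4) : x != y ->
  (forall i j : 'I_4, (nth 0 [:: 0; 1; 2; 3] i < nth 0 [:: 0; 1; 2; 3] j)%N -> H i j = 0) ->
  (forall i j : 'I_4, (nth 0 [:: 3; 2; 1; 0] i < nth 0 [:: 3; 2; 1; 0] j)%N -> H i j = 0) ->
  (forall i j : 'I_4, (nth 0 [:: 0; 0; 1; 1] i < nth 0 [:: 0; 0; 1; 1] j)%N -> T i j = 0) ->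
  rows_mx _ (E7_rows x) *m H = T *m rows_mx _ (E7_rows y) -> H 0 0 = 0.
Proof.
move=> xy Hb Hc Ta GH; have [h [t [-> E]]] := orth_equations Hb Hc Ta GH.
have := (E 0%N 0%N isT isT, E 0%N 1%N isT isT, E 0%N 2%N isT isT, E 0%N 3%N isT isT,
         E 1%N 0%N isT isT, E 1%N 1%N isT isT, E 1%N 2%N isT isT, E 1%N 3%N isT isT).
rewrite /index_iota /= !big_cons !big_nil /= !simp0.
case=> [[[[[[[e00 e01] e02] e03] e10] e11] e12] e13].
rewrite -e01 -?e10 ?mul0r ?addr0 ?add0r in e02 e03 e12 e13.
by rewrite e00; apply: (eigen_eq xy); rewrite -{1}e03 e13 -e12 e02.
Qed.

(** Off the diagonal only the entries (i, i + 3) of H survive, and the equations at these places are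
    left out. Rows 0 and 2 equate the diagonal entries 0, 3, 4, 5 to some u, and row 1 gives x u = u
    y. *)
Lemma E8_orth (x y : K) (H T : 'M[K]_6) : x != y ->
  (forall i j : 'I_6, (nth 0 [:: 2; 1; 0; 2; 1; 0] i < nth 0 [:: 2; 1; 0; 2; 1; 0] j)%N ->
     H i j = 0) ->
  (forall i j : 'I_6, (nth 0 [:: 1; 3; 5; 0; 2; 4] i < nth 0 [:: 1; 3; 5; 0; 2; 4] j)%N ->
     H i j = 0) ->
  (forall i j : 'I_6, (nth 0 [:: 0; 0; 0; 1; 1; 1] i < nth 0 [:: 0; 0; 0; 1; 1; 1] j)%N ->
     T i j = 0) ->
  rows_mx _ (E8_rows x) *m H = T *m rows_mx _ (E8_rows y) -> H 0 0 = 0.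
Proof.
move=> xy Hb Hc Ta GH; have [h [t [-> E]]] := orth_equations Hb Hc Ta GH.
have := (E 0%N 0%N isT isT, E 0%N 1%N isT isT, E 0%N 2%N isT isT, E 0%N 4%N isT isT,
         E 0%N 5%N isT isT, E 1%N 0%N isT isT, E 1%N 2%N isT isT, E 1%N 3%N isT isT,
         E 1%N 5%N isT isT, E 2%N 0%N isT isT, E 2%N 1%N isT isT, E 2%N 3%N isT isT,
         E 2%N 4%N isT isT).
rewrite /index_iota /= !big_cons !big_nil /= !simp0.
case=> [[[[[[[[[[[[e00 e01] e02] e04] e05] e10] e12] e13] e15] e20] e21] e23] e24].
rewrite -?e01 -?e02 -?e10 -?e12 -?e20 -?e21 ?mul0r ?addr0 ?add0r in e04 e05 e13 e15 e23 e24.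
by rewrite e00; apply: (eigen_eq xy); rewrite -{1}e05 e15 -e13 e23 -e24 e04.
Qed.

End CriticalFamilies.

Local Close Scope ring_scope.

Lemma sumn_nonzero_parts a : sumn (nonzero_parts a) = sumn a.
Proof. by elim: a => //= x a <-; case: eqP => [->|]. Qed.

Lemma mul_size_le_sumn d y : all (leq d) y -> d * size y <= sumn y.
Proof. by elim: y => [|x y IH] /=; [rewrite muln0 | move=> /andP[? /IH]; rewrite mulnS; lia]. Qed.

Lemma min_part_le a : all (leq (min_part a)) (nonzero_parts a).
Proof.
rewrite /min_part; move: (head _ _) => z.
elim: (nonzero_parts a) => //= x y IH; rewrite big_cons geq_minl /=.
by apply: sub_all IH => u; apply: leq_trans; rewrite geq_minr.
Qed.

Lemma nonzero_parts_gt0 a : all (leq 1) (nonzero_parts a).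
Proof. by apply/allP => x; rewrite mem_filter lt0n => /andP[]. Qed.

Lemma min_part_gt0 a : 0 < size (nonzero_parts a) -> 0 < min_part a.
Proof.
have pos z y : 0 < z -> all (leq 1) y -> 0 < \big[minn/z]_(x <- y) x.
  move=> z0; elim: y => [|u y IH] /=; first by rewrite big_nil.
  by move=> /andP[u0 /IH]; rewrite big_cons leq_min u0.
move=> sz; apply: pos; last exact: nonzero_parts_gt0.
by move: (nonzero_parts_gt0 a) sz; case: (nonzero_parts a) => //= x y /andP[].
Qed.

(** * Types that dominate a critical type *)

Section InfiniteType.
Variables (K : closedFieldType) (V : vectType K) (n : nat).
Hypothesis dimV : \dim {:V} = n.

Lemma pattern_coloring a pat d m k : size pat = m -> sumn a = m + k ->
    all (leq d) (nonzero_parts a) ->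
    all (fun c => c < size (nonzero_parts a)) pat ->
    (forall c, count_mem c pat <= d) ->
  exists col : 'I_(m + k) -> nat,
    [/\ forall j, col j < size a,
        forall t, t < size a -> #|[pred j | col j == t]| = nth 0 a t &
        forall i j : 'I_m, nth 0 pat i < nth 0 pat j ->
          col (lshift k i) < col (lshift k j)].
Proof.
move=> spat suma /all_nthP ged pat_lt le_d; apply: coloring_exists => // c cs.
exact: leq_trans (le_d c) (ged 0 c cs).
Qed.

Variables (a b c : seq nat).
Hypotheses (sum_a : sumn a = n) (sum_b : sumn b = n) (sum_c : sumn c = n).

(** A pattern uses each color at most [da] times ([db], [dc]) and every non-zero part is at least
    that large, so the critical triple fits inside; the remaining n - m - 1 basis vectors span the
    fixed complement. *)
Lemma pattern_infinite m (r : K -> seq (seq K)) pa pb pc da db dc :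
    m.+1 <= n -> (forall x, rows_mx m.+1 (r x) \in unitmx) ->
    size pa = m.+1 -> size pb = m.+1 -> size pc = m.+1 ->
    all (leq da) (nonzero_parts a) -> all (leq db) (nonzero_parts b) ->
    all (leq dc) (nonzero_parts c) ->
    all (fun i => i < size (nonzero_parts a)) pa ->
    all (fun i => i < size (nonzero_parts b)) pb ->
    all (fun i => i < size (nonzero_parts c)) pc ->
    (forall i, [&& count_mem i pa <= da, count_mem i pb <= db & count_mem i pc <= dc]) ->
    (forall (x y : K) (H T : 'M[K]_m.+1), x != y ->
      (forall i j : 'I_m.+1, (nth 0 pb i < nth 0 pb j)%N -> H i j = 0) ->
      (forall i j : 'I_m.+1, (nth 0 pc i < nth 0 pc j)%N -> H i j = 0) ->
      (forall i j : 'I_m.+1, (nth 0 pa i < nth 0 pa j)%N -> T i j = 0) ->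
      rows_mx _ (r x) *m H = T *m rows_mx _ (r y) -> H 0 0 = 0)%R ->
  ~ finite_type V a b c.
Proof.
move=> mn ur sa sb sc ga gb gc la lb lc cnt orth.
have nE : n = m.+1 + (n - m.+1) by rewrite subnKC.
move: (n - m.+1) nE => k nE.
have [B bV] : exists B : (m.+1 + k).-tuple V, basis_of fullv B.
  by rewrite -nE -dimV; exists (vbasis fullv); apply: vbasisP.
have [ca Pa] : exists ca : 'I_(m.+1 + k) -> nat, is_coloring a pa ca.
  by apply: (pattern_coloring sa _ ga la) => [|i]; [rewrite sum_a|case/and3P: (cnt i)].
have [cb Pb] : exists cb : 'I_(m.+1 + k) -> nat, is_coloring b pb cb.
  by apply: (pattern_coloring sb _ gb lb) => [|i]; [rewrite sum_b|case/and3P: (cnt i)].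
have [cc Pc] : exists cc : 'I_(m.+1 + k) -> nat, is_coloring c pc cc.
  by apply: (pattern_coloring sc _ gc lc) => [|i]; [rewrite sum_c|case/and3P: (cnt i)].
pose G x := rows_mx m.+1 (r x).
exact: (@family_infinite_type K V m k B bV G ur a b c pa pb pc orth ca cb cc Pa Pb Pc).
Qed.

End InfiniteType.

Theorem theorem2p2 (K : closedFieldType) (V : vectType K) (n : nat)
    (a b c : seq nat) (p q r : nat)
    (n_ge1 : 1 <= n) (dimV : \dim {:V} = n)
    (sum_a : sumn a = n) (sum_b : sumn b = n) (sum_c : sumn c = n)
    (def_p : p = size (nonzero_parts a))
    (def_q : q = size (nonzero_parts b))
    (def_r : r = size (nonzero_parts c))
    (le_pq : p <= q) (le_qr : q <= r) :
  finite_type V a b c <->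
    (* A_{q,r} *)     (p = 1 /\ 1 <= q <= r) \/
    (* D_{r+2} *)     (p = 2 /\ q = 2 /\ 2 <= r) \/
    (* E_6 *)         (p = 2 /\ q = 3 /\ r = 3) \/
    (* E_7 *)         (p = 2 /\ q = 3 /\ r = 4) \/
    (* E_8 *)         (p = 2 /\ q = 3 /\ r = 5) \/
    (* E^(a)_{r+3} *) (p = 2 /\ q = 3 /\ 3 <= r /\ min_part a = 2) \/
    (* E^(b)_{r+3} *) (p = 2 /\ q = 3 /\ 3 <= r /\ min_part b = 1) \/
    (* S_{q,r} *)     (p = 2 /\ 2 <= q <= r /\ min_part a = 1).
Proof.
split=> [fin|cls]; last first.
  apply: tits_pos_finite_type => ya yb yc m la lb lc sa sb sc m0.
  by apply: (tits_form_pos _ la lb lc sa sb sc m0); rewrite -def_p -def_q -def_r.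
have ge_d l d : sumn l = n -> all (leq d) (nonzero_parts l) ->
    d * size (nonzero_parts l) <= n.
  by move=> <- ged; rewrite -(sumn_nonzero_parts l) mul_size_le_sumn.
have p0 : 0 < p.
  rewrite def_p lt0n size_eq0; apply: contraTneq n_ge1 => a0.
  by rewrite -sum_a -(sumn_nonzero_parts a) a0.
have mina : 0 < min_part a by apply: min_part_gt0; rewrite -def_p.
have minb : 0 < min_part b by apply: min_part_gt0; rewrite -def_q (leq_trans p0).
have [p1|p_neq1] := eqVneq p 1; first by left; lia.
have [p2|p_neq2] := eqVneq p 2; last first.
  (* All three flags have at least three parts, dominating (111|111|111). *)
  case: (@pattern_infinite K V n dimV a b c sum_a sum_b sum_c 2 (@E6_rows K)
    [:: 0; 1; 2] [:: 0; 1; 2] [:: 2; 1; 0] 1 1 1 _ (@E6_unit K)) => //;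
    try exact: nonzero_parts_gt0; try by rewrite /= -?def_p -?def_q -?def_r; lia.
  - by have := ge_d a 1 sum_a (nonzero_parts_gt0 a); rewrite -def_p; lia.
  - exact: E6_orth.
have [mina1|mina_neq1] := eqVneq (min_part a) 1; first by do 7!right; lia.
have [q2|q_neq2] := eqVneq q 2; first by right; left; lia.
have [q3|q_neq3] := eqVneq q 3; last first.
  have ga : all (leq 2) (nonzero_parts a).
    by apply: sub_all (min_part_le a) => x; apply: leq_trans; lia.
  (* The parts of a are at least 2 and q, r >= 4, dominating (22|1111|1111). *)
  case: (@pattern_infinite K V n dimV a b c sum_a sum_b sum_c 3 (@E7_rows K)
    [:: 0; 0; 1; 1] [:: 0; 1; 2; 3] [:: 3; 2; 1; 0] 2 1 1 _ (@E7_unit K)) => //;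
    try exact: nonzero_parts_gt0; try by rewrite /= -?def_p -?def_q -?def_r; lia.
  - by have := ge_d a 2 sum_a ga; rewrite -def_p; lia.
  - exact: E7_orth.
have [r5|r6] := leqP r 5; first by clear - p2 q3 le_qr r5; lia.
have [mina2|mina_neq2] := eqVneq (min_part a) 2; first by do 5!right; left; lia.
have [minb1|minb_neq1] := eqVneq (min_part b) 1; first by do 6!right; left; lia.
have ga : all (leq 3) (nonzero_parts a).
  by apply: sub_all (min_part_le a) => x; apply: leq_trans; lia.
have gb : all (leq 2) (nonzero_parts b).
  by apply: sub_all (min_part_le b) => x; apply: leq_trans; lia.
(* The parts of a are at least 3, the three parts of b at least 2, and r >= 6, dominating
   (33|222|111111). *)
case: (@pattern_infinite K V n dimV a b c sum_a sum_b sum_c 5 (@E8_rows K)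
  [:: 0; 0; 0; 1; 1; 1] [:: 2; 1; 0; 2; 1; 0] [:: 1; 3; 5; 0; 2; 4] 3 2 1 _ (@E8_unit K)) => //;
  try exact: nonzero_parts_gt0; try by rewrite /= -?def_p -?def_q -?def_r; lia.
- by have := ge_d a 3 sum_a ga; rewrite -def_p; lia.
- exact: E8_orth.
Qed.
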